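(* Let $n\geq 3$ and $m\geq 3$ be integers. Then $\Delta_m^{n,2}=\mathrm{VR}(\{0,1,\ldots,m\}^n;2)$ is homotopy equivalent to a wedge sum $\bigvee^{\nu_m}\mathbb{S}^3$ of $\nu_m$ copies of the $3$-sphere, where $\nu_m\geq (m-2)^3$.
   Context: $\{0,1,\ldots,m\}^n\subseteq\mathbb{Z}^n$ carries the Manhattan metric $d(x,y)=\sum_{i=1}^n |x_i-y_i|$. For a metric space $X$ and $r\geq 0$, $\mathrm{VR}(X;r)$ is the simplicial complex with vertex set $X$ whose simplices are the finite subsets of $X$ of diameter at most $r$. *)

(* Defs.v *)
From HB Require Import structures.
From mathcomp Require Import all_boot all_order all_algebra.
From mathcomp Require Import all_classical all_reals all_analysis.
From mathcomp Require Import homotopy.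
Import numFieldNormedType.Exports.
Set Implicit Arguments. Unset Strict Implicit. Unset Printing Implicit Defensive.
Import Order.TTheory GRing.Theory Num.Theory.
Local Open Scope classical_set_scope.
Local Open Scope ring_scope.

Definition grid (n m : nat) : finType := {ffun 'I_n -> 'I_m.+1}.

Definition manhattan (n m : nat) (x y : grid n m) : nat :=
  (\sum_(i < n) `|(x i : nat) - (y i : nat)|)%N.

Definition VR_simplex (n m r : nat) (s : {set grid n m}) : bool :=
  (0 < #|s|)%N &&
  [forall x in s, [forall y in s, (manhattan x y <= r)%N]].

(** Geometric realization of a (finite) simplicial complex on a finite vertex
    set V, given by its simplex predicate: barycentric-coordinate functions
    V -> R, nonnegative, summing to 1, whose support is a simplex.  It carries
    the subspace topology of the product R^V (set_type topology). *)
Definition realization_set (R : realType) (V : finType) (simplex : {set V} -> bool)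
  : set {ptws V -> R} :=
  [set x | (forall v, 0 <= x v) /\ (\sum_(v : V) x v = 1) /\
           simplex (finset (fun v => x v != 0))].

Definition realization (R : realType) (V : finType) (simplex : {set V} -> bool)
  : topologicalType := set_type (@realization_set R V simplex).

Definition sphere3_set (R : realType) : set {ptws 'I_4 -> R} :=
  [set x | \sum_(i < 4) x i ^+ 2 = 1].

Definition sphere3 (R : realType) : topologicalType := set_type (@sphere3_set R).

Definition north_pt (R : realType) : {ptws 'I_4 -> R} :=
  fun i => if i == ord0 then 1 else 0.

Lemma north_in_sphere3 (R : realType) : @north_pt R \in @sphere3_set R.
Proof.
apply/mem_set; rewrite /sphere3_set /north_pt /=.
rewrite big_ord_recl /= big1 ?addr0 ?expr1n // => i _.
by rewrite expr0n.
Qed.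

Definition north (R : realType) : @sphere3 R := exist _ (@north_pt R) (@north_in_sphere3 R).

Definition wedge_S3 (R : realType) (k : nat) : topologicalType :=
  @wedge 'I_k (fun _ => sphere3 R) (fun _ => north R).

Definition homotopic (R : realType) (X Y : topologicalType) (f g : X -> Y) : Prop :=
  exists H : X * R -> Y,
    {within [set p : X * R | 0 <= p.2 <= 1], continuous H} /\
    (forall x, H (x, 0) = f x) /\ (forall x, H (x, 1) = g x).

Definition homotopy_equivalent (R : realType) (X Y : topologicalType) : Prop :=
  exists (f : X -> Y) (g : Y -> X),
    continuous f /\ continuous g /\
    homotopic R (g \o f) idfun /\ homotopic R (f \o g) idfun.

(* Main.v *)
(* A regular tetrahedron inscribed in a unit 3-cube is a maximal simplex of the
   complex.  Deleting a suitable set T of them leaves a collapsible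
   complex K0, so the quotient of the realization by K0 is a wedge of #|T|
   three-spheres, one for each deleted tetrahedron, and it is homotopy equivalent
   to the realization because K0 is contractible.

   Collapsibility: the vertices are removed in decreasing order of the weight
   sum_i (n - i) x_i.  The link of x in the remaining vertices consists of the
   points x - e_i, x - 2e_i, x - e_i - e_j and x - e_i + e_j with i < j.  Its
   edges joining x - e_j + e_k to x - e_l + e_k would create loops, one for each
   pair j, l < k; a tetrahedron fills each of these, and those through the
   smallest i0 with x_i0 > 0 are kept and used to collapse the edges, while the
   others are redundant and deleted, and so are those lying below x.

   Homotopy equivalence: K0 is contracted by a globally defined map c.  One map
   pinches K0 to the base point and sends each deleted tetrahedron onto a sphere;
   the other dilates each tetrahedron by 2 about its barycentre and follows c on
   the part pushed out of it, which is the end of the homotopy [deform]. *)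

Require Import Defs.
From HB Require Import structures.
From mathcomp Require Import all_boot all_order all_algebra.
From mathcomp Require Import all_classical all_reals all_analysis.
From mathcomp Require Import homotopy.
From mathcomp Require Import ring lra zify.
Import numFieldNormedType.Exports.
Set Implicit Arguments. Unset Strict Implicit. Unset Printing Implicit Defensive.
Import Order.TTheory GRing.Theory Num.Theory.
Local Open Scope classical_set_scope.
Local Open Scope ring_scope.

(** * Continuity *)

(** Passing to the quotient by K0 would call for a homotopy extension argument; writing the maps
    down replaces it by continuity questions, and global formulas settle most of these. On points
    with nonnegative coordinates the least coordinate over a face vanishes off the open star of that
    face, so a displacement multiplied by it needs no gluing. Two difficulties remain. The
    contraction [c] is controlled only on K0, so it is driven by a clock, [excess], which becomes
    positive only after dilation has brought the point into K0. And the chart of a facet breaks down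
    at the north pole of its sphere; the clock runs fast enough to make the map out of the sphere
    constant near that pole. No degree is computed: on each sphere the composite sends no point to
    its antipode, which already makes it homotopic to the identity with the base point fixed. On the
    combinatorial side, faces are removed in batches, and inside a batch no apex may lie in a
    removed face. For most batches this is parity: the apexes are at distance 1 from x, the vertices
    of the faces at distance 0 or 2. *)

Section ContinuityToolkit.
Context {R : realType} {X : topologicalType}.
Implicit Types (f g : X -> R) (x : X).

Lemma eq_cts {Y : topologicalType} (f g : X -> Y) x :
  f =1 g -> {for x, continuous f} -> {for x, continuous g}.
Proof. by move=> /funext->. Qed.

Lemma cts_cst (a : R) x : {for x, continuous (fun _ : X => a)}.
Proof. exact: cvg_cst. Qed.

Lemma cts_D f g x : {for x, continuous f} -> {for x, continuous g} ->
  {for x, continuous (fun y => f y + g y)}.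
Proof. exact: continuousD. Qed.

Lemma cts_N f x : {for x, continuous f} -> {for x, continuous (fun y => - f y)}.
Proof. exact: continuousN. Qed.

Lemma cts_M f g x : {for x, continuous f} -> {for x, continuous g} ->
  {for x, continuous (fun y => f y * g y)}.
Proof. exact: continuousM. Qed.

Lemma cts_X f x k : {for x, continuous f} ->
  {for x, continuous (fun y => f y ^+ k)}.
Proof.
move=> cf; elim: k => [|k IHk]; first exact: cts_cst.
by apply: (eq_cts (fun y => esym (exprS (f y) k))); apply: cts_M.
Qed.

Lemma cts_V f x : f x != 0 -> {for x, continuous f} ->
  {for x, continuous (fun y => (f y)^-1)}.
Proof. exact: continuousV. Qed.

Lemma cts_min f g x : {for x, continuous f} -> {for x, continuous g} ->
  {for x, continuous (fun y => Num.min (f y) (g y))}.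
Proof. exact: continuous_min. Qed.

Lemma cts_max f g x : {for x, continuous f} -> {for x, continuous g} ->
  {for x, continuous (fun y => Num.max (f y) (g y))}.
Proof. exact: continuous_max. Qed.

Lemma cts_sqrt f x : {for x, continuous f} ->
  {for x, continuous (fun y => Num.sqrt (f y))}.
Proof. move=> cf; apply: continuous_comp => //; exact: sqrt_continuous. Qed.

Lemma cts_sum (I : Type) (r : seq I) (P : pred I) (F : I -> X -> R) x :
  (forall i, P i -> {for x, continuous (F i)}) ->
  {for x, continuous (fun y => \sum_(i <- r | P i) F i y)}.
Proof.
move=> cF; elim: r => [|i r IHr].
  by apply: (@eq_cts _ (fun=> 0)); [move=> y; rewrite big_nil|exact: cts_cst].
case Pi: (P i).
  apply: (@eq_cts _ (fun y => F i y + \sum_(i <- r | P i) F i y)).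
    by move=> y; rewrite big_cons Pi.
  by apply: cts_D => //; apply: cF.
by apply: eq_cts IHr => y; rewrite big_cons Pi.
Qed.

Lemma cts_bigmin (I : Type) (r : seq I) (P : pred I) (F : I -> X -> R) (a : R) x :
  (forall i, P i -> {for x, continuous (F i)}) ->
  {for x, continuous (fun y => \big[Num.min/a]_(i <- r | P i) F i y)}.
Proof.
move=> cF; elim: r => [|i r IHr].
  by apply: (@eq_cts _ (fun=> a)); [move=> y; rewrite big_nil|exact: cts_cst].
case Pi: (P i).
  apply: (@eq_cts _ (fun y => Num.min (F i y) (\big[Num.min/a]_(i <- r | P i) F i y))).
    by move=> y; rewrite big_cons Pi.
  by apply: cts_min => //; apply: cF.
by apply: eq_cts IHr => y; rewrite big_cons Pi.
Qed.

Lemma cts_ptws (I : choiceType) (f : X -> {ptws I -> R}) x :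
  (forall i, {for x, continuous (fun y => f y i)}) -> {for x, continuous f}.
Proof.
move=> cf; apply/cvg_sup => i U [_ [[W oW <-] Wfx] WU].
apply: (filterS WU); apply: (cf i); exact: open_nbhs_nbhs.
Qed.

Lemma cts_coord (I : choiceType) (f : X -> {ptws I -> R}) x i :
  {for x, continuous f} -> {for x, continuous (fun y => f y i)}.
Proof.
move=> cf; apply: (@continuous_comp _ _ _ f (proj i)) => //.
exact: proj_continuous.
Qed.

Lemma cts_sub (Y : topologicalType) (A : set Y) (f : X -> set_type A) x :
  {for x, continuous (fun y => set_val (f y))} -> {for x, continuous f}.
Proof.
move=> cf U [_ [[W oW <-] Wfx] WU]; apply: filterS WU _; apply: cf.
exact: open_nbhs_nbhs.
Qed.

Lemma cts_val (Y : topologicalType) (A : set Y) (f : X -> set_type A) x :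
  {for x, continuous f} -> {for x, continuous (fun y => set_val (f y))}.
Proof.
move=> cf; apply: (@continuous_comp _ _ _ f set_val) => //.
exact: initial_continuous.
Qed.

Lemma cts_pair (Y Z : topologicalType) (f : X -> Y) (g : X -> Z) x :
  {for x, continuous f} -> {for x, continuous g} ->
  {for x, continuous (fun y => (f y, g y))}.
Proof. exact: cvg_pair. Qed.

End ContinuityToolkit.

Lemma near_finite_all {X : topologicalType} (I : finType) (x : X)
  (P : I -> X -> Prop) : (forall i, \forall y \near x, P i y) ->
  \forall y \near x, forall i, P i y.
Proof.
move=> nP; suff : \forall y \near x, forall i, i \in enum I -> P i y.
  by apply: filterS => y Py i; apply: Py; rewrite mem_enum.
elim: (enum I) => [|j s IHs]; first by apply: nearW.
by apply: filterS2 (nP j) IHs => y Pj Ps i; rewrite inE => /predU1P[->//|/Ps].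
Qed.

(** * Collapses *)

(** Time runs over all of [R]; clamping makes a homotopy stationary outside the unit interval, so
    that it is continuous on the whole line. *)
Definition clamp {R : realType} (t : R) : R := Num.max 0 (Num.min 1 t).

Lemma clamp_itv {R : realType} (t : R) : 0 <= clamp t <= 1.
Proof. by rewrite /clamp le_max lexx ge_max ler01 ge_min lexx. Qed.

Lemma clamp_le0 {R : realType} (t : R) : t <= 0 -> clamp t = 0.
Proof. by move=> t0; rewrite /clamp max_l// ge_min t0 orbT. Qed.

Lemma clamp_ge1 {R : realType} (t : R) : 1 <= t -> clamp t = 1.
Proof. by move=> t1; rewrite /clamp min_l// max_r. Qed.

Section MinCoord.
Context {R : realType} {V : finType}.
Implicit Types (s : {set V}) (x : V -> R).

(** For nonnegative [x] this is positive exactly when [s] lies in the support. The default 1 is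
    consistent with coordinates of a realization, which are at most 1. *)
Definition mincoord s x : R := \big[Num.min/1]_(u in s) x u.

Definition supp x : {set V} := finset (fun v => x v != 0).

Lemma in_supp x u : (u \in supp x) = (x u != 0).
Proof. by rewrite /supp inE. Qed.

Lemma mincoord_le s x u : u \in s -> mincoord s x <= x u.
Proof. by move=> us; rewrite /mincoord; apply: bigmin_le_cond. Qed.

Lemma mincoord_ge0 s x : (forall u, 0 <= x u) -> 0 <= mincoord s x.
Proof. by move=> x0; apply/bigmin_geP; split=> // u _; exact: x0. Qed.

Lemma mincoord_eq0 s x : (forall u, 0 <= x u) ->
  ~~ (s \subset supp x) -> mincoord s x = 0.
Proof.
move=> x0 /fintype.subsetPn[u us]; rewrite in_supp negbK => /eqP xu.
by apply/eqP; rewrite eq_le mincoord_ge0// -xu mincoord_le.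
Qed.

Lemma mincoord_attained s x : s != finset.set0 -> (forall u, x u <= 1) ->
  exists2 u, u \in s & mincoord s x = x u.
Proof.
move=> /set0Pn[u us] x1; rewrite /mincoord.
have [//|i is_ ->] := @eq_bigmin _ _ _ 1 u (mem s) x us; by exists i.
Qed.

Lemma mincoord_gt0 s x : (forall u, 0 <= x u) -> s \subset supp x ->
  0 < mincoord s x.
Proof.
move=> x0 /fintype.subsetP sx; apply/bigmin_gtP; split=> // u /sx.
by rewrite in_supp lt_neqAle eq_sym x0 andbT.
Qed.

End MinCoord.

Section Collapse.
Context {R : realType} {V : finType}.
Implicit Types (K : {set V} -> bool) (tau s : {set V}) (v : V).

(* Pushes the open star of [tau] towards [v]; outside that star [mincoord tau]
   vanishes, which makes one formula continuous on the whole space. *)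
Definition push tau v (p : {ptws V -> R} * R) : {ptws V -> R} :=
  fun u => p.1 u + clamp p.2 * mincoord tau p.1 *
    (if u == v then #|tau|%:R else if u \in tau then - 1 else 0).

Lemma push_continuous tau v : continuous (push tau v).
Proof.
move=> p; apply: cts_ptws => u; apply: cts_D.
  by apply: cts_coord; exact: cvg_fst.
apply: cts_M; last exact: cts_cst.
apply: cts_M.
  by apply: cts_max; [|apply: cts_min]; try exact: cts_cst; exact: cvg_snd.
by apply: cts_bigmin => w _; apply: cts_coord; exact: cvg_fst.
Qed.

Lemma push_le0 tau v x t : t <= 0 -> push tau v (x, t) = x.
Proof. by move=> t0; apply/funext => u; rewrite /push/= clamp_le0// !mul0r addr0. Qed.

Lemma realization_le1 K x : realization_set K x -> forall u, x u <= 1 :> R.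
Proof.
case=> x0 [<- _] u; rewrite (bigD1 u)//= lerDl sumr_ge0// => w _; exact: x0.
Qed.

Lemma push_ge0 tau v x t u : v \notin tau -> (forall w, 0 <= x w) ->
  0 <= push tau v (x, t) u.
Proof.
move=> vtau x0; have /andP[t0 t1] := clamp_itv t; rewrite /push/=.
have m0 := mincoord_ge0 tau x0.
case: ifP => _; first by rewrite addr_ge0// !mulr_ge0.
case: ifP => utau; last by rewrite mulr0 addr0.
rewrite mulrN1 subr_ge0 (le_trans _ (mincoord_le x utau))//.
by rewrite ler_piMl.
Qed.

Lemma push_sum tau v x t : v \notin tau ->
  \sum_u push tau v (x, t) u = \sum_u x u.
Proof.
move=> vtau; rewrite /push/= big_split/= -[RHS]addr0; congr (_ + _).
rewrite -mulr_sumr (bigD1 v)//= eqxx [X in _ + X](_ : _ = - #|tau|%:R).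
  by rewrite subrr mulr0.
rewrite -sum1_card natr_sum -sumrN big_mkcond [RHS]big_mkcond/=.
apply: eq_bigr => u _; case: eqVneq => [->|uv]; first by rewrite (negbTE vtau).
by case: ifP.
Qed.

Lemma push_supp tau v x t : (forall w, 0 <= x w) -> v \notin tau ->
  tau \subset supp x -> supp (push tau v (x, t)) \subset v |: supp x.
Proof.
move=> x0 vtau tx; apply/fintype.subsetP => u; rewrite in_supp finset.in_setU1 in_supp /push/=.
case: (eqVneq u v) => //= uv; case: ifP => utau.
  by move: (fintype.subsetP tx u utau); rewrite in_supp.
by rewrite mulr0 addr0.
Qed.

Lemma push_id tau v x t : (forall w, 0 <= x w) ->
  ~~ (tau \subset supp x) -> push tau v (x, t) = x.
Proof.
move=> x0 tx; apply/funext => u; rewrite /push/=.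
by rewrite mincoord_eq0// mulr0 mul0r addr0.
Qed.

(* Strong form of an elementary collapse: the link of [tau] is a cone with
   apex [v], and the open star of [tau] is removed. *)
Definition removable K tau v : Prop :=
  [/\ tau != finset.set0, v \notin tau &
      forall s, K s -> tau \subset s -> K (v |: s)].

Definition down_closed K : Prop :=
  forall s s', K s -> s' != finset.set0 -> s' \subset s -> K s'.

Lemma realization_supp0 K (x : {ptws V -> R}) :
  (\sum_v x v = 1) -> supp x != finset.set0.
Proof.
move=> sx; apply/set0Pn; apply: contrapT => /forallNP x0.
move: sx; rewrite big1 => [/eqP|u _]; first by rewrite eq_sym oner_eq0.
by apply/eqP; apply: contrapT => /negP; move: (x0 u); rewrite in_supp.
Qed.

Lemma push_realization K tau v x t : down_closed K -> removable K tau v ->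
  realization_set K x -> realization_set K (push tau v (x, t)).
Proof.
move=> dK [tau0 vtau Ktau] [x0 [sx Kx]].
have sp : \sum_u push tau v (x, t) u = 1 by rewrite push_sum.
split=> [u|]; first exact: push_ge0.
split=> //; have [tx|tx] := boolP (tau \subset supp x); last by rewrite push_id.
apply: dK (Ktau _ Kx tx) _ _; last exact: push_supp.
exact: (realization_supp0 K).
Qed.

(** At time 1 each coordinate on [tau] has lost the smallest of them, so a vertex attaining the
    minimum leaves the support. *)
Lemma push_realization1 K tau v x t : down_closed K -> removable K tau v ->
  realization_set K x -> 1 <= t ->
  realization_set (fun s => K s && ~~ (tau \subset s)) (push tau v (x, t)).
Proof.
move=> dK rK Kx t1; have [y0 [sy Ky]] := push_realization t dK rK Kx.
split=> //; split=> //; apply/andP; split=> //.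
have [x0 _] := Kx; have [tau0 vtau _] := rK.
have [tx|tx] := boolP (tau \subset supp x); last by rewrite push_id.
have [u utau xu] := mincoord_attained tau0 (realization_le1 Kx).
apply/fintype.subsetPn; exists u => //; rewrite in_supp negbK /push/= utau.
have -> : (u == v) = false by apply/eqP => uv; rewrite -uv utau in vtau.
by rewrite clamp_ge1// mul1r mulrN1 xu subrr.
Qed.

Definition vertex (p : V) : {ptws V -> R} := fun u => (u == p)%:R.

(* The contraction is defined and continuous on all of R^V x R, so that it can
   be composed with other maps without any continuity side condition. *)
Definition contractible K (p : V) : Prop :=
  exists c : {ptws V -> R} * R -> {ptws V -> R},
  [/\ continuous c, forall x t, t <= 0 -> c (x, t) = x,
      forall x t, realization_set K x -> realization_set K (c (x, t)) &
      forall x t, realization_set K x -> 1 <= t -> c (x, t) = vertex p].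

Lemma contractible_vertex (p : V) :
  contractible (fun s => s == finset.set1 p) p.
Proof.
exists fst; split=> //= [x|x t [x0 [sx /eqP xp]] _]; first exact: cvg_fst.
have xE u : u != p -> x u = 0.
  move=> up; apply/eqP; apply: contrapT => /negP xu.
  have : u \in supp x by rewrite in_supp.
  by rewrite /supp xp inE (negbTE up).
apply/funext => u; rewrite /vertex; have [->|/xE//] := eqVneq u p.
by rewrite -sx (bigD1 p)//= big1 ?addr0// => i /xE.
Qed.

Lemma contractible_step K tau v p : down_closed K -> removable K tau v ->
  contractible (fun s => K s && ~~ (tau \subset s)) p -> contractible K p.
Proof.
move=> dK rK [c [cc c0 cK c1]].
have sub x : realization_set (fun s => K s && ~~ (tau \subset s)) x ->
    realization_set (R := R) K x.
  by case=> x0 [sx /andP[Kx _]].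
exists (fun p => c (push tau v (p.1, 2 * p.2), 2 * p.2 - 1)); split => /=.
- move=> q; apply: (@continuous_comp _ _ _
    (fun q : {ptws V -> R} * R => (push tau v (q.1, 2 * q.2), 2 * q.2 - 1)) c);
    last exact: cc.
  have c2 : {for q, continuous (fun q : {ptws V -> R} * R => 2 * q.2)}.
    by apply: cts_M; [exact: cts_cst|exact: cvg_snd].
  apply: cts_pair; last by apply: cts_D => //; exact: cts_cst.
  apply: (@continuous_comp _ _ _
    (fun q : {ptws V -> R} * R => (q.1, 2 * q.2)) (push tau v));
    last exact: push_continuous.
  by apply: cts_pair => //; exact: cvg_fst.
- move=> x t t0; rewrite c0; first by apply: push_le0; lra.
  lra.
- move=> x t Kx; have [h|h] := leP (2 * t - 1) 0.
    by rewrite c0//; exact: push_realization.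
  by apply/sub/cK/push_realization1 => //; lra.
- move=> x t Kx t1; apply: c1; last lra.
  by apply: push_realization1 => //; lra.
Qed.

Lemma down_closed_avoid K tau : down_closed K ->
  down_closed (fun s => K s && ~~ (tau \subset s)).
Proof.
move=> dK s s' /andP[Ks ts] s'0 ss'; rewrite (dK s)//=.
by apply: contra ts => /fintype.subset_trans; apply.
Qed.

Lemma eq_contractible K K' p : K =1 K' -> contractible K p -> contractible K' p.
Proof. by move=> /funext->. Qed.

Definition avoid (B : {set V} -> V -> Prop) K : {set V} -> bool := fun s =>
  K s && [forall tau, `[< exists v, B tau v >] ==> ~~ (tau \subset s)].

Lemma avoidP B K s : avoid B K s <->
  K s /\ forall tau v, B tau v -> ~~ (tau \subset s).
Proof.
split=> [/andP[Ks /forallP h]|[Ks h]].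
  split=> // tau v Bt; move: (h tau); rewrite (_ : `[< _ >] = true)//.
  by apply/asboolT; exists v.
by apply/andP; split=> //; apply/forallP => tau; apply/implyP => /asboolP[v /h].
Qed.

Lemma avoidW B K s : avoid B K s -> K s. Proof. by case/andP. Qed.

Lemma avoid_add B K s v : avoid B K s -> K (v |: s) ->
  (forall tau v', B tau v' -> v \notin tau) -> avoid B K (v |: s).
Proof.
move=> /avoidP[_ h] Kv vB; apply/avoidP; split=> // tau v' Bt.
apply: contra (h _ _ Bt) => /fintype.subsetP tvs; apply/fintype.subsetP => u ut.
have := tvs u ut; rewrite !inE => /predU1P[uv|//].
by have := vB _ _ Bt; rewrite -uv ut.
Qed.

Lemma avoid_down_closed B K : down_closed K -> down_closed (avoid B K).
Proof.
move=> dK s s' /avoidP[Ks h] s'0 ss'; apply/avoidP; split; first exact: dK ss'.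
move=> tau v /h; apply: contra => ts; exact: fintype.subset_trans ss'.
Qed.

(* As the apexes avoid all the removed faces, adding an apex to a simplex never
   brings back a face removed earlier, so the order of removal is irrelevant. *)
Lemma contractible_batch K (B : {set V} -> V -> Prop) p : down_closed K ->
  (forall tau v, B tau v -> removable K tau v) ->
  (forall tau v tau' v', B tau v -> B tau' v' -> v \notin tau') ->
  contractible (avoid B K) p -> contractible K p.
Proof.
move=> dK rB BB.
set K1 := (X in contractible X p).
pose T := [seq tau <- enum {set V} | `[< exists v, B tau v >]].
have TB tau : tau \in T -> exists v, B tau v.
  by rewrite mem_filter => /andP[/asboolP].
have -> : K1 = fun s => K s && all (fun tau => ~~ (tau \subset s)) T.
  apply/funext => s; rewrite /K1 /avoid; congr (_ && _); apply/forallP/allP.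
    move=> h tau; rewrite mem_filter => /andP[Bt _].
    by move: (h tau); rewrite Bt.
  by move=> h tau; apply/implyP => Bt; apply: h; rewrite mem_filter Bt mem_enum.
elim: T K dK rB TB {K1} => [|tau T IH] K dK rB TB.
  by apply: eq_contractible => s; rewrite andbT.
move=> h; have [v Btau] := TB tau (mem_head _ _).
apply: (contractible_step dK (rB _ _ Btau)); apply: IH.
- exact: down_closed_avoid.
- move=> tau' v' Btau'; have [t0 vt Kt] := rB _ _ Btau'; split=> // s.
  move=> /andP[Ks ts] t's; rewrite Kt//=; apply: contra ts => /fintype.subsetP ts.
  apply/fintype.subsetP => u ut; have := ts u ut; rewrite !inE => /predU1P[uv'|//].
  by move: (BB _ _ _ _ Btau' Btau); rewrite -uv' ut.
- by move=> tau' Ttau'; apply: TB; rewrite inE Ttau' orbT.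
- by apply: eq_contractible h => s /=; rewrite andbA.
Qed.

End Collapse.

(** * Spheres *)

Section SubsetPoint.
Context {Y : topologicalType} {A : set Y}.
Implicit Types (d : set_type A) (y : Y).

(** The default [d] makes this total, so maps into a subspace are written as ambient formulas and
    membership is proved separately. *)
Definition to_subset d y : set_type A :=
  if pselect (A y) is left Ay then exist _ y (mem_set Ay) else d.

Lemma to_subsetE d y : A y -> set_val (to_subset d y) = y.
Proof. by rewrite /to_subset; case: pselect. Qed.

Lemma set_val_inj : injective (set_val : set_type A -> Y).
Proof. exact: val_inj. Qed.

Lemma set_val_continuous : continuous (set_val : set_type A -> Y).
Proof. exact: initial_continuous. Qed.

End SubsetPoint.

Section Fin4.
Definition o1 : 'I_4 := @Ordinal 4 1 isT.
Definition o2 : 'I_4 := @Ordinal 4 2 isT.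
Definition o3 : 'I_4 := @Ordinal 4 3 isT.

Lemma forall4 (P : 'I_4 -> Prop) : P ord0 -> P o1 -> P o2 -> P o3 -> forall k, P k.
Proof.
move=> P0 P1 P2 P3 [[|[|[|[|//]]]] lk].
- by rewrite (_ : Ordinal lk = ord0)//; exact: val_inj.
- by rewrite (_ : Ordinal lk = o1)//; exact: val_inj.
- by rewrite (_ : Ordinal lk = o2)//; exact: val_inj.
- by rewrite (_ : Ordinal lk = o3)//; exact: val_inj.
Qed.

Lemma sum4 {R : nmodType} (F : 'I_4 -> R) :
  \sum_k F k = F ord0 + F o1 + F o2 + F o3.
Proof.
rewrite !big_ord_recl big_ord0 addr0 !addrA.
by do !congr (_ + _); congr F; exact: val_inj.
Qed.

End Fin4.

Section Sphere.
Context {R : realType}.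
Implicit Types w : {ptws 'I_4 -> R}.

Lemma sphere3E w : sphere3_set w ->
  w ord0 ^+ 2 + w o1 ^+ 2 + w o2 ^+ 2 + w o3 ^+ 2 = 1.
Proof. by rewrite /sphere3_set/= sum4. Qed.

Lemma sphere_le1 w : sphere3_set w -> w ord0 <= 1.
Proof.
move=> /sphere3E h; rewrite leNgt; apply/negP => w1.
have := sqr_ge0 (w o1); have := sqr_ge0 (w o2); have := sqr_ge0 (w o3).
nra.
Qed.

Lemma sphere_north w : sphere3_set w -> w ord0 = 1 -> w = @north_pt R.
Proof.
move=> /sphere3E h w0; apply/funext.
have h1 := sqr_ge0 (w o1); have h2 := sqr_ge0 (w o2); have h3 := sqr_ge0 (w o3).
rewrite w0 in h.
have z (a : R) : a ^+ 2 <= 0 -> a = 0.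
  by move=> a0; apply/eqP; rewrite -sqrf_eq0 eq_le a0 sqr_ge0.
by apply: forall4; rewrite /north_pt/= ?w0//; apply: z; lra.
Qed.

Lemma north_sphere : sphere3_set (@north_pt R).
Proof. exact/set_mem/north_in_sphere3. Qed.

Definition sph (w : {ptws 'I_4 -> R}) : sphere3 R := to_subset (@north R) w.

Lemma sphE w : sphere3_set w -> set_val (sph w) = w.
Proof. exact: to_subsetE. Qed.

Lemma set_val_sphere (w : sphere3 R) : sphere3_set (set_val w).
Proof. exact: set_valP. Qed.

Lemma sphK (w : sphere3 R) : sph (set_val w) = w.
Proof. by apply: set_val_inj; rewrite sphE//; exact: set_val_sphere. Qed.

Lemma sph_north : sph (@north_pt R) = north R.
Proof. exact: (sphK (north R)). Qed.

Lemma sphere3_eq_north (w : sphere3 R) : set_val w ord0 = 1 -> w = north R.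
Proof. by move=> w0; rewrite -sph_north -(sphere_north _ w0) ?sphK//; exact: set_val_sphere. Qed.

(** Joint continuity of a homotopy on the wedge requires closed base points. Points are closed
    because the sphere embeds in a product of Hausdorff lines. *)
Lemma closed_north : closed [set north R].
Proof.
apply: accessible_closed_set1; apply: hausdorff_accessible => a b ab.
apply: set_val_inj; apply: (@hausdorff_product 'I_4 (fun=> R)) => [_|U W aU bW].
  exact: Rhausdorff.
have [| |z [zU zW]] := ab (set_val @^-1` U) (set_val @^-1` W).
- exact: (set_val_continuous aU).
- exact: (set_val_continuous bW).
by exists (set_val z).
Qed.

Definition chord (u w : {ptws 'I_4 -> R}) (t : R) : {ptws 'I_4 -> R} :=
  fun k => (1 - t) * u k + t * w k.

Definition norm4 (v : {ptws 'I_4 -> R}) : R := Num.sqrt (\sum_k v k ^+ 2).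

(** The radial projection of the chord: it follows the great circle, though not at constant
    speed. *)
Definition slerp (u w : {ptws 'I_4 -> R}) (t : R) : {ptws 'I_4 -> R} :=
  fun k => chord u w t k / norm4 (chord u w t).

Lemma norm4_gt0 (v : {ptws 'I_4 -> R}) k : v k != 0 -> 0 < norm4 v.
Proof.
move=> vk; rewrite /norm4 sqrtr_gt0 (bigD1 k)//= ltr_wpDr//.
  by rewrite sumr_ge0// => j _; rewrite sqr_ge0.
by rewrite lt_neqAle sqr_ge0 eq_sym sqrf_eq0 vk.
Qed.

(** If the chord met the origin, comparing the norms of [(1 - t) u] and [t w] would give [t = 1/2],
    and then [u = - w]. *)
Lemma chord_neq0 u w t : sphere3_set u -> sphere3_set w ->
  (exists k, u k != - w k) -> exists k, chord u w t k != 0.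
Proof.
move=> /sphere3E su /sphere3E sw [k uw]; apply: contrapT => /forallNP h.
have z j : (1 - t) * u j + t * w j = 0 by apply/eqP; apply: contrapT => /negP/h.
have := z ord0; have := z o1; have := z o2; have := z o3 => z3 z2 z1 z0.
have sq (a b : R) : (1 - t) * a + t * b = 0 ->
    (1 - t) ^+ 2 * a ^+ 2 = t ^+ 2 * b ^+ 2.
  by move=> /eqP; rewrite addr_eq0 => /eqP ab; rewrite -!exprMn ab sqrrN.
have e0 := sq _ _ z0; have e1 := sq _ _ z1.
have e2 := sq _ _ z2; have e3 := sq _ _ z3.
have : (1 - t) ^+ 2 = t ^+ 2.
  have e : (1 - t) ^+ 2 * (u ord0 ^+ 2 + u o1 ^+ 2 + u o2 ^+ 2 + u o3 ^+ 2) =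
      t ^+ 2 * (w ord0 ^+ 2 + w o1 ^+ 2 + w o2 ^+ 2 + w o3 ^+ 2).
    by rewrite !mulrDr e0 e1 e2 e3.
  by rewrite su sw !mulr1 in e.
move=> tt; have t2 : t = 2^-1 by lra.
by move/negP: uw; apply; apply/eqP; have := z k; rewrite t2; lra.
Qed.

Lemma slerp_sphere u w t : (exists k, chord u w t k != 0) ->
  sphere3_set (slerp u w t).
Proof.
move=> [k ck]; rewrite /sphere3_set/= /slerp.
under eq_bigr do rewrite exprMn.
rewrite -mulr_suml exprVn /norm4 sqr_sqrtr.
  rewrite divff// gt_eqF// -sqrtr_gt0; exact: norm4_gt0 ck.
by rewrite sumr_ge0// => j _; rewrite sqr_ge0.
Qed.

Lemma norm4_sphere w : sphere3_set w -> norm4 w = 1.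
Proof. by rewrite /sphere3_set/norm4/= => ->; rewrite sqrtr1. Qed.

Lemma slerp0 u w : sphere3_set u -> slerp u w 0 = u.
Proof.
move=> su; have uE : chord u w 0 = u.
  by apply/funext => k; rewrite /chord; lra.
by apply/funext => k; rewrite /slerp uE norm4_sphere// divr1.
Qed.

Lemma slerp1 u w : sphere3_set w -> slerp u w 1 = w.
Proof.
move=> sw; have wE : chord u w 1 = w.
  by apply/funext => k; rewrite /chord; lra.
by apply/funext => k; rewrite /slerp wE norm4_sphere// divr1.
Qed.

Lemma cts_chord {X : topologicalType} (u w : X -> {ptws 'I_4 -> R}) (t : X -> R) x k :
  {for x, continuous u} -> {for x, continuous w} -> {for x, continuous t} ->
  {for x, continuous (fun z => chord (u z) (w z) (t z) k)}.
Proof.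
move=> cu cw ct; apply: cts_D; apply: cts_M => //; try exact: cts_coord.
by apply: cts_D; [exact: cts_cst|exact: cts_N].
Qed.

Lemma cts_slerp {X : topologicalType} (u w : X -> {ptws 'I_4 -> R}) (t : X -> R) x :
  (exists k, chord (u x) (w x) (t x) k != 0) ->
  {for x, continuous u} -> {for x, continuous w} -> {for x, continuous t} ->
  {for x, continuous (fun z => slerp (u z) (w z) (t z))}.
Proof.
move=> [k ck] cu cw ct; apply: cts_ptws => j; apply: cts_M.
  exact: cts_chord.
apply: cts_V; first by rewrite gt_eqF//; exact: norm4_gt0 ck.
by apply: cts_sqrt; apply: cts_sum => l _; apply: cts_X; exact: cts_chord.
Qed.

(** With no point sent to its antipode, the chord from [k w] to [w] misses the origin and can be
    projected. The base point stays fixed, which allows these homotopies to be glued over a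
    wedge. *)
Lemma slerp_homotopic (k : sphere3 R -> sphere3 R) : continuous k ->
  (forall w : sphere3 R, exists j, set_val (k w) j != - set_val w j) ->
  k (north R) = north R ->
  exists h : R -> sphere3 R -> sphere3 R,
  [/\ continuous (uncurry h), forall w : sphere3 R, h 0 w = k w, forall w : sphere3 R, h 1 w = w &
      forall t, h t (north R) = north R].
Proof.
move=> ck kN kn.
have nz (w : sphere3 R) t : exists j, chord (set_val (k w)) (set_val w) t j != 0.
  apply: chord_neq0; [exact: set_val_sphere|exact: set_val_sphere|exact: kN].
exists (fun t (w : sphere3 R) => sph (slerp (set_val (k w)) (set_val w) t)); split.
- move=> [t w]; apply: cts_sub.
  apply: (@eq_cts _ _ (fun p : R * sphere3 R =>
      slerp (set_val (k p.2)) (set_val p.2) p.1)).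
    by move=> [t' w'] /=; rewrite sphE//; exact: slerp_sphere.
  apply: cts_slerp; first exact: nz.
  + apply: cts_val; apply: continuous_comp; [exact: cvg_snd|exact: ck].
  + apply: cts_val; exact: cvg_snd.
  + exact: cvg_fst.
- by move=> w; rewrite slerp0 ?sphK//; exact: set_val_sphere.
- by move=> w; rewrite slerp1 ?sphK//; exact: set_val_sphere.
- move=> t; rewrite kn -[RHS]sph_north; congr sph; set a := set_val _.
  have sa : sphere3_set a by exact: set_val_sphere.
  have aE : chord a a t = a by apply/funext => j; rewrite /chord; lra.
  apply/funext => j; rewrite /slerp aE norm4_sphere// divr1.
  by rewrite /a set_valE.
Qed.

End Sphere.

(** * Wedges of spheres from facets *)

Section Facets.
Context {R : realType} {V : finType} (K : {set V} -> bool) (nu : nat).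
Context (sg : 'I_nu -> {set V}) (p : V).
Hypothesis sg_inj : injective sg.
Hypothesis sg_card : forall i, #|sg i| = 4%N.
Hypothesis sg_facet : forall i s, K s -> sg i \subset s -> s = sg i.
Hypothesis sgK : forall i, K (sg i).
Hypothesis dK : down_closed K.

Definition deleted : {set V} -> bool := fun s => K s && [forall i, s != sg i].

Hypothesis K0p : deleted (finset.set1 p).
Context (c : {ptws V -> R} * R -> {ptws V -> R}).
Hypothesis cc : continuous c.
Hypothesis c_le0 : forall x t, t <= 0 -> c (x, t) = x.
Hypothesis cK0 : forall x t, realization_set deleted x -> realization_set deleted (c (x, t)).
Hypothesis c_ge1 : forall x t, realization_set deleted x -> 1 <= t -> c (x, t) = vertex p.

Implicit Types (x : {ptws V -> R}) (i : 'I_nu).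

Let m i x := mincoord (sg i) x.

Lemma deletedW x : realization_set deleted x -> realization_set K x.
Proof. by case=> x0 [sx /andP[Kx _]]. Qed.

(** Maximality of [sg i] enters here; it makes the open facets pairwise disjoint. *)
Lemma facet_supp i x : realization_set K x -> 0 < m i x -> supp x = sg i.
Proof.
move=> [x0 [sx Kx]] mx; apply: sg_facet => //.
by apply: contraTT mx => /(mincoord_eq0 x0); rewrite /m => ->; rewrite ltxx.
Qed.

Lemma facet_unique i j x : realization_set K x -> 0 < m i x -> j != i -> m j x = 0.
Proof.
move=> Kx mx ji; have [x0 _] := Kx; apply/eqP; rewrite eq_le mincoord_ge0// andbT.
rewrite leNgt; apply: contra ji => mj; apply/eqP/sg_inj.
by rewrite -(facet_supp Kx mx) -(facet_supp Kx mj).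
Qed.

Lemma deletedP x : realization_set K x ->
  realization_set deleted x <-> forall i, m i x = 0.
Proof.
move=> Kx; have [x0 [sx Ksx]] := Kx; split=> [[_ [_ /andP[_ /forallP h]]] i|h].
  apply/eqP; rewrite eq_le mincoord_ge0// andbT leNgt; apply/negP => mi.
  by have /negP := h i; apply; apply/eqP; exact: facet_supp.
split=> //; split=> //; apply/andP; split=> //; apply/forallP => i.
apply/negP => /eqP xi; have si : sg i \subset supp x by rewrite /supp xi.
by have := mincoord_gt0 x0 si; rewrite -/(m i x) h ltxx.
Qed.

Lemma facet_case x : realization_set K x ->
  (exists2 i, 0 < m i x & forall j, j != i -> m j x = 0) \/ (forall i, m i x = 0).
Proof.
move=> Kx; have [x0 _] := Kx; have [[i mi]|h] := pselect (exists i, 0 < m i x).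
  by left; exists i => // j; exact: facet_unique.
right=> i; apply/eqP; rewrite eq_le mincoord_ge0// andbT leNgt.
by apply/negP => mi; apply: h; exists i.
Qed.

Definition e i (k : 'I_4) : V := enum_val (cast_ord (esym (sg_card i)) k).

Lemma e_in i k : e i k \in sg i.
Proof. exact: enum_valP. Qed.

Lemma e_inj i : injective (e i).
Proof. by move=> a b /enum_val_inj /cast_ord_inj. Qed.

Lemma e_surj i u : u \in sg i -> exists k, u = e i k.
Proof.
move=> us; exists (cast_ord (sg_card i) (enum_rank_in us u)).
by rewrite /e cast_ordK enum_rankK_in.
Qed.

Lemma sum_e i (F : V -> R) : (forall u, u \notin sg i -> F u = 0) ->
  \sum_u F u = F (e i ord0) + F (e i o1) + F (e i o2) + F (e i o3).
Proof.
move=> F0; rewrite -(sum4 (fun k => F (e i k))) (bigID (mem (sg i)))/=.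
rewrite [X in _ + X]big1 ?addr0// big_enum_val (reindex (cast_ord (esym (sg_card i))))//=.
by exists (cast_ord (sg_card i)) => a _; rewrite (cast_ordK, cast_ordKV).
Qed.

Lemma facet_sum i x : realization_set K x -> 0 < m i x ->
  x (e i ord0) + x (e i o1) + x (e i o2) + x (e i o3) = 1.
Proof.
move=> Kx mx; have [_ [<- _]] := Kx; rewrite (sum_e (i := i))// => u.
by rewrite -(facet_supp Kx mx) in_supp negbK => /eqP.
Qed.

Lemma m_attained i x : realization_set K x -> exists k, m i x = x (e i k).
Proof.
move=> Kx; have s0 : sg i != finset.set0 by rewrite -cards_eq0 sg_card.
have [u us xu] := mincoord_attained s0 (realization_le1 Kx).
by have [k uk] := e_surj us; exists k; rewrite /m xu uk.
Qed.

Lemma m_le i x k : m i x <= x (e i k).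
Proof. exact/mincoord_le/e_in. Qed.

(** The cap [mu / (1/4 - mu)] is the coefficient at which the least coordinate [mu] reaches 0. The
    bound 1/8 keeps the denominator away from 0 at the barycentre; for [mu >= 1/8] the cap is at
    least 1, so it does not restrict times up to 1. *)
Definition lam (t mu : R) : R := Num.min t (mu / Num.max (4^-1 - mu) 8^-1).

Definition bary i : {ptws V -> R} := fun u => if u \in sg i then 4^-1 else 0.

(* Dilation of each facet about its barycentre, by a factor [1 + t] as long as
   the point stays in the facet; it fixes the complement of the open facets. *)
Definition stretch (q : {ptws V -> R} * R) : {ptws V -> R} :=
  fun u => q.1 u + \sum_i lam q.2 (m i q.1) * (q.1 u - bary i u).

(** Measured from the barycentre, [(1 - 4 mu) (1 + t)] is the radius of the uncapped dilate and
    equals 1 on the boundary of the facet. The factor 2 makes the overshoot reach 1 at [t = 1]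
    already for [mu <= 1/16]. At most one term of the sum is nonzero on the realization. *)
Definition excess (q : {ptws V -> R} * R) : R :=
  2 * ((1 - 4 * \sum_i m i q.1) * (1 + q.2) - 1).

Definition deform (q : {ptws V -> R} * R) : {ptws V -> R} :=
  c (stretch q, excess q).

Lemma cts_m {X : topologicalType} (f : X -> {ptws V -> R}) z i :
  {for z, continuous f} -> {for z, continuous (fun y => m i (f y))}.
Proof. by move=> cf; apply: cts_bigmin => u _; exact: cts_coord. Qed.

Lemma cts_lam {X : topologicalType} (f g : X -> R) z :
  {for z, continuous f} -> {for z, continuous g} ->
  {for z, continuous (fun y => lam (f y) (g y))}.
Proof.
move=> cf cg; apply: cts_min => //; apply: cts_M => //; apply: cts_V.
  by rewrite gt_eqF// lt_max; apply/orP; right; lra.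
apply: cts_max; last exact: cts_cst.
by apply: cts_D; [exact: cts_cst|exact: cts_N].
Qed.

Lemma stretch_continuous : continuous stretch.
Proof.
move=> q; apply: cts_ptws => u.
have c1 : {for q, continuous (fun y : {ptws V -> R} * R => y.1 u)}.
  by apply: cts_coord; exact: cvg_fst.
apply: cts_D => //; apply: cts_sum => i _; apply: cts_M.
  by apply: cts_lam; [exact: cvg_snd|apply: cts_m; exact: cvg_fst].
by apply: cts_D => //; exact: cts_cst.
Qed.

Lemma deform_continuous : continuous deform.
Proof.
move=> q; apply: (@continuous_comp _ _ _ (fun q => (stretch q, excess q)) c);
  last exact: cc.
apply: cts_pair; first exact: stretch_continuous.
apply: cts_M; first exact: cts_cst.
apply: cts_D; last exact: cts_cst.
apply: cts_M; apply: cts_D; try exact: cts_cst; last exact: cvg_snd.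
apply: cts_N; apply: cts_M; first exact: cts_cst.
by apply: cts_sum => i _; apply: cts_m; exact: cvg_fst.
Qed.

Lemma lam0 (t : R) : 0 <= t -> lam t 0 = 0.
Proof. by move=> t0; rewrite /lam mul0r min_r. Qed.

Lemma stretch_id x t : 0 <= t -> (forall i, m i x = 0) -> stretch (x, t) = x.
Proof.
move=> t0 mx; apply/funext => u; rewrite /stretch/= big1 ?addr0// => i _.
by rewrite mx lam0// mul0r.
Qed.

Lemma stretch_facet i x t u : 0 <= t -> realization_set K x -> 0 < m i x ->
  stretch (x, t) u = x u + lam t (m i x) * (x u - bary i u).
Proof.
move=> t0 Kx mx; rewrite /stretch/= (bigD1 i)//= big1 ?addr0// => j ji.
by rewrite (facet_unique Kx mx)// lam0// mul0r.
Qed.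

Lemma excess_facet i x t : realization_set K x -> 0 < m i x ->
  excess (x, t) = 2 * ((1 - 4 * m i x) * (1 + t) - 1).
Proof.
move=> Kx mx; rewrite /excess/= (bigD1 i)//= big1 ?addr0// => j ji.
exact: (facet_unique Kx mx).
Qed.

Lemma lam_bounds (t mu : R) : 0 <= t -> 0 <= mu -> 0 <= lam t mu /\
  lam t mu * (4^-1 - mu) <= mu.
Proof.
move=> t0 mu0; set M := Num.max (4^-1 - mu) 8^-1.
have M0 : 0 < M by rewrite /M lt_max; apply/orP; right; lra.
have l0 : 0 <= lam t mu by rewrite /lam le_min t0 divr_ge0// ltW.
split=> //; have l1 : lam t mu * M <= mu.
  by rewrite -ler_pdivlMr// /lam ge_min lexx orbT.
apply: le_trans l1; rewrite ler_wpM2l// /M le_max lexx//.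
Qed.

Lemma lam_hit (t mu : R) : 0 <= t <= 1 -> 0 <= mu -> 1 <= (1 - 4 * mu) * (1 + t) ->
  lam t mu * (4^-1 - mu) = mu.
Proof.
move=> /andP[t0 t1] mu0 h.
(* As [t <= 1], the hypothesis gives [1 - 4 mu >= 1/2]; in this range the denominator of [lam] is
   [1/4 - mu]. *)
have mu8 : mu <= 8^-1 by nra.
have -> : lam t mu = mu / (4^-1 - mu).
  rewrite /lam max_l; last lra.
  rewrite min_r// ler_pdivrMr; last lra.
  by lra.
by rewrite divfK// gt_eqF//; lra.
Qed.

Lemma stretch_supp i x t : 0 <= t -> realization_set K x -> 0 < m i x ->
  supp (stretch (x, t)) \subset sg i.
Proof.
move=> t0 Kx mx; apply/fintype.subsetP => u; rewrite in_supp.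
apply: contraR => us; rewrite (stretch_facet _ t0 Kx mx) /bary (negbTE us).
move: us; rewrite -(facet_supp Kx mx) in_supp negbK => /eqP ->.
by rewrite subrr mulr0 addr0.
Qed.

Lemma stretch_realization x t : 0 <= t -> realization_set K x ->
  realization_set K (stretch (x, t)).
Proof.
move=> t0 Kx; have [[i mx _]|] := facet_case Kx; last first.
  by move=> mx; rewrite stretch_id.
have ss := stretch_supp t0 Kx mx; have sE := stretch_facet _ t0 Kx mx.
have [x0 _] := Kx; have [l0 l1] := lam_bounds t0 (ltW mx).
have st : \sum_v stretch (x, t) v = 1.
  rewrite (sum_e (i := i)); last first.
    move=> u us; apply/eqP; apply: contraNT us => us.
    by apply: (fintype.subsetP ss); rewrite in_supp.
  rewrite !sE /bary !e_in; have := facet_sum Kx mx => sm; nra.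
split=> [u|].
  have [us|us] := boolP (u \in sg i); last first.
    move: us; apply: contraR; rewrite -ltNge => us; apply: (fintype.subsetP ss).
    by rewrite in_supp lt_eqF.
  by rewrite sE /bary us; have := mincoord_le x us; rewrite -/(m i x); nra.
split=> //; apply: (dK (sgK i)) => //; exact: (realization_supp0 K st).
Qed.

(** By [lam_hit] the least coordinate on [sg i] becomes 0. No other deleted facet can be entered, as
    the support stays inside [sg i]. *)
Lemma stretch_deleted i x t : 0 <= t <= 1 -> realization_set K x -> 0 < m i x ->
  1 <= (1 - 4 * m i x) * (1 + t) -> realization_set deleted (stretch (x, t)).
Proof.
move=> t01 Kx mx h; have t0 : 0 <= t by case/andP: t01.
have KE := stretch_realization t0 Kx; apply/(deletedP KE).
have [[j mj _]|//] := facet_case KE.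
have ij : i = j.
  apply: sg_inj; apply: sg_facet => //.
  by rewrite -(facet_supp KE mj) stretch_supp.
move: mj; rewrite -ij; have [k xk] := m_attained i Kx.
have := m_le i (stretch (x, t)) k.
rewrite (stretch_facet _ t0 Kx mx) /bary e_in -xk.
by have := lam_hit t01 (ltW mx) h; lra.
Qed.

(** While the excess is nonpositive [c] does nothing; once it is positive the stretched point lies
    in the deleted subcomplex, which [c] preserves. *)
Lemma deform_realization x t : 0 <= t <= 1 -> realization_set K x ->
  realization_set K (deform (x, t)).
Proof.
move=> t01 Kx; have t0 : 0 <= t by case/andP: t01.
rewrite /deform; have [h|h] := leP (excess (x, t)) 0.
  by rewrite c_le0//; exact: stretch_realization.
apply/deletedW/cK0; have [[i mx _]|mx] := facet_case Kx.
  apply: (stretch_deleted t01 Kx mx).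
  by move: h; rewrite (excess_facet _ Kx mx); lra.
by rewrite stretch_id//; exact/(deletedP Kx).
Qed.

Lemma deform0 x : realization_set K x -> deform (x, 0) = x.
Proof.
move=> Kx; have lam0E mu : 0 <= mu -> lam 0 mu = 0.
  move=> mu0; rewrite /lam min_l// divr_ge0// le_max; apply/orP; right; lra.
have [x0 _] := Kx.
have sE : stretch (x, 0) = x.
  apply/funext => u; rewrite /stretch/= big1 ?addr0// => i _.
  by rewrite lam0E ?mul0r//; exact: mincoord_ge0.
rewrite /deform sE c_le0// /excess/= addr0 mulr1.
have : 0 <= \sum_i m i x by rewrite sumr_ge0// => i _; exact: mincoord_ge0.
lra.
Qed.

Lemma deform1_deleted x : realization_set deleted x -> deform (x, 1) = vertex p.
Proof.
move=> K0x; have Kx := deletedW K0x; have mx := (deletedP Kx).1 K0x.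
rewrite /deform stretch_id// c_ge1// /excess/= big1 //; lra.
Qed.

Lemma vertex_deleted : realization_set deleted (vertex p : {ptws V -> R}).
Proof.
have sE : supp (vertex p : V -> R) = finset.set1 p.
  by apply/setP => u; rewrite in_supp finset.in_set1 /vertex pnatr_eq0 eqb0 negbK.
split=> [u|]; first by rewrite /vertex ler0n.
split; last by move: sE; rewrite /supp => ->.
rewrite (bigD1 p)//= big1 ?addr0 /vertex ?eqxx// => u up.
by rewrite (negbTE up).
Qed.


(** * Stereographic projection between a facet and the sphere *)

Definition rad i x : R :=
  (x (e i o1) - 4^-1) ^+ 2 + (x (e i o2) - 4^-1) ^+ 2 + (x (e i o3) - 4^-1) ^+ 2 +
  (1 - (x (e i ord0) + x (e i o1) + x (e i o2) + x (e i o3))) ^+ 2.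

(* On the facet [sg i] this is inverse stereographic projection applied to the
   vector [(x - barycentre) / m i x]; everything else goes to the north pole. *)
Definition facet_to_sphere i x : {ptws 'I_4 -> R} := fun k =>
  if k == ord0 then (rad i x - m i x ^+ 2) / (rad i x + m i x ^+ 2)
  else 2 * m i x * (x (e i k) - 4^-1) / (rad i x + m i x ^+ 2).

(** If everything vanished, the last square in [rad] would make all four coordinates 1/4,
    contradicting the vanishing of their minimum. So one formula is continuous on the whole
    realization. *)
Lemma rad_gt0 i x : realization_set K x -> 0 < rad i x + m i x ^+ 2.
Proof.
move=> Kx; rewrite ltNge; apply/negP; rewrite /rad => h.
have [k mk] := m_attained i Kx; move: h.
have := sqr_ge0 (x (e i o1) - 4^-1); have := sqr_ge0 (x (e i o2) - 4^-1).
have := sqr_ge0 (x (e i o3) - 4^-1); have := sqr_ge0 (m i x).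
have := sqr_ge0 (1 - (x (e i ord0) + x (e i o1) + x (e i o2) + x (e i o3))).
move=> h1 h2 h3 h4 h5 h.
have z (a : R) : a ^+ 2 <= 0 -> a = 0.
  by move=> a0; apply/eqP; rewrite -sqrf_eq0 eq_le a0 sqr_ge0.
have m0 : m i x = 0 by apply: z; lra.
have x1 : x (e i o1) = 4^-1 by apply/eqP; rewrite -subr_eq0; apply/eqP/z; lra.
have x2 : x (e i o2) = 4^-1 by apply/eqP; rewrite -subr_eq0; apply/eqP/z; lra.
have x3 : x (e i o3) = 4^-1 by apply/eqP; rewrite -subr_eq0; apply/eqP/z; lra.
have s1 : 1 - (x (e i ord0) + x (e i o1) + x (e i o2) + x (e i o3)) = 0 by apply: z; lra.
have : x (e i k) = 4^-1 by move: k {mk}; apply: forall4; lra.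
by rewrite -mk m0; lra.
Qed.

Lemma facet_to_sphere_north i x : realization_set K x -> m i x = 0 ->
  facet_to_sphere i x = @north_pt R.
Proof.
move=> Kx mx; have r0 := rad_gt0 i Kx; apply/funext => k.
rewrite /facet_to_sphere /north_pt mx; case: eqP => _.
  by rewrite expr0n subr0 addr0 divff//; move: r0; rewrite mx expr0n addr0 => /gt_eqF ->.
by rewrite mulr0 !mul0r.
Qed.

Lemma facet_to_sphereP i x : realization_set K x -> sphere3_set (facet_to_sphere i x).
Proof.
move=> Kx; have r0 := rad_gt0 i Kx; have [x0 _] := Kx.
have := mincoord_ge0 (sg i) x0; rewrite -/(m i x) le_eqVlt => /predU1P[/esym m0|mx].
  by rewrite facet_to_sphere_north//; exact: north_sphere.
rewrite /sphere3_set/= sum4 /facet_to_sphere/= !expr_div_n -!mulrDl.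
set N := rad i x + _ in r0 *; rewrite (_ : _ + _ = N ^+ 2) ?divff//.
  by rewrite sqrf_eq0 gt_eqF.
by rewrite /N /rad (facet_sum Kx mx); ring.
Qed.

Lemma cts_rad_m {X : topologicalType} (f : X -> {ptws V -> R}) z i :
  {for z, continuous f} ->
  {for z, continuous (fun y => rad i (f y))}.
Proof.
move=> cf; have cx k : {for z, continuous (fun y => f y (e i k))} by exact: cts_coord.
have c4 k : {for z, continuous (fun y => (f y (e i k) - 4^-1) ^+ 2)}.
  by apply: cts_X; apply: cts_D; [exact: cx|exact: cts_cst].
apply: cts_D; last first.
  apply: cts_X; apply: cts_D; first exact: cts_cst.
  apply: cts_N; apply: cts_D; last exact: cx.
  by apply: cts_D; [apply: cts_D; exact: cx|exact: cx].
by apply: cts_D; [apply: cts_D; exact: c4|exact: c4].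
Qed.

Lemma cts_facet_to_sphere {X : topologicalType} (f : X -> {ptws V -> R}) z i :
  realization_set K (f z) -> {for z, continuous f} ->
  {for z, continuous (fun y => facet_to_sphere i (f y))}.
Proof.
move=> Kz cf; have cr := cts_rad_m (i := i) cf; have cm := cts_m (i := i) cf.
have cN : {for z, continuous (fun y => (rad i (f y) + m i (f y) ^+ 2)^-1)}.
  apply: cts_V; first by rewrite gt_eqF//; exact: rad_gt0.
  by apply: cts_D => //; exact: cts_X.
apply: cts_ptws => k; rewrite /facet_to_sphere; case: (k == ord0).
  apply: cts_M; last exact: cN.
  by apply: cts_D; [exact: cr|apply: cts_N; exact: cts_X].
apply: cts_M; last exact: cN.
apply: cts_M; first by apply: cts_M; [exact: cts_cst|exact: cm].
by apply: cts_D; [exact: cts_coord|exact: cts_cst].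
Qed.

Implicit Types w : {ptws 'I_4 -> R}.

(* A vector of R^3 is recorded by four coordinates of sum 0, that is, by a
   direction in the affine hull of the facet. *)
Definition sum0_coord w (k : 'I_4) : R :=
  if k == ord0 then - (w o1 + w o2 + w o3) else w k.

Definition eta w : R := Num.min (sum0_coord w ord0)
  (Num.min (w o1) (Num.min (w o2) (w o3))).

(** Let [v] be the stereographic image of [w]. Requiring that [x = barycentre + mu v] have least
    coordinate [mu] gives [mu = (1 - w ord0) / (4 * den w)], and the displacement from the
    barycentre is then [sum0_coord w / (4 * den w)]. *)
Definition den w : R := 1 - w ord0 - eta w.

Definition sphere_to_facet i w : {ptws V -> R} := fun u =>
  \sum_(k < 4) (u == e i k)%:R * (4^-1 + sum0_coord w k / (4 * den w)).

Lemma eta_le w k : eta w <= sum0_coord w k.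
Proof.
by move: k; apply: forall4; rewrite /eta /sum0_coord/= !ge_min !lexx ?orbT.
Qed.

Lemma eta_attained w : exists k, eta w = sum0_coord w k.
Proof.
rewrite /eta; case: leP => _; first by exists ord0.
case: leP => _; first by exists o1.
by case: leP => _; [exists o2|exists o3].
Qed.

Lemma eta_le0 w : eta w <= 0.
Proof.
have := eta_le w ord0; have := eta_le w o1; have := eta_le w o2; have := eta_le w o3.
by rewrite /sum0_coord/=; lra.
Qed.

Lemma den_gt0 w : sphere3_set w -> w ord0 != 1 -> 0 < den w.
Proof.
move=> sw w1; have : w ord0 < 1 by rewrite lt_neqAle w1 sphere_le1.
by have := eta_le0 w; rewrite /den; lra.
Qed.

Lemma sphere_to_facet_e i w k :
  sphere_to_facet i w (e i k) = 4^-1 + sum0_coord w k / (4 * den w).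
Proof.
rewrite /sphere_to_facet (bigD1 k)//= eqxx mul1r big1 ?addr0// => j jk.
by rewrite (inj_eq (@e_inj i)) eq_sym (negbTE jk) mul0r.
Qed.

Lemma sphere_to_facet_out i w u : u \notin sg i -> sphere_to_facet i w u = 0.
Proof.
move=> us; rewrite /sphere_to_facet big1// => k _.
by case: eqP => [uk|]; rewrite ?mul0r//; rewrite uk e_in in us.
Qed.

Lemma m_eq i x a : (forall k, a <= x (e i k)) -> (exists k, x (e i k) = a) ->
  a <= 1 -> m i x = a.
Proof.
move=> ax [k ka] a1; apply/eqP; rewrite eq_le -{1}ka m_le/=.
by apply/bigmin_geP; split=> // u us; have [j ->] := e_surj us.
Qed.

Lemma sphere_to_facetP i w : sphere3_set w -> w ord0 != 1 ->
  [/\ realization_set K (sphere_to_facet i w), 0 < m i (sphere_to_facet i w) &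
      m i (sphere_to_facet i w) * (4 * den w) = 1 - w ord0].
Proof.
move=> sw w1; have d0 := den_gt0 sw w1; set x := sphere_to_facet i w.
have w1' : w ord0 < 1 by rewrite lt_neqAle w1 sphere_le1.
have mE : m i x = (1 - w ord0) / (4 * den w).
  have kE k : x (e i k) = (den w + sum0_coord w k) / (4 * den w).
    by rewrite /x sphere_to_facet_e; field; rewrite gt_eqF.
  apply: m_eq => [k||].
  - rewrite kE ler_pM2r ?invr_gt0 ?mulr_gt0//.
    by have := eta_le w k; rewrite /den; lra.
  - have [k ek] := eta_attained w; exists k; rewrite kE -ek.
    by congr (_ / _); rewrite /den; ring.
  - rewrite ler_pdivrMr ?mulr_gt0// mul1r.
    by have := eta_le0 w; rewrite /den; lra.
have m0 : 0 < m i x by rewrite mE divr_gt0 ?subr_gt0 ?mulr_gt0.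
have x0 u : 0 <= x u.
  have [us|us] := boolP (u \in sg i); last by rewrite /x sphere_to_facet_out.
  by apply: le_trans (ltW m0) _; exact: mincoord_le.
have sx : \sum_u x u = 1.
  rewrite (sum_e (i := i)) => [|u us]; last by rewrite /x sphere_to_facet_out.
  rewrite /x !sphere_to_facet_e /sum0_coord/=.
  by field; rewrite gt_eqF.
split=> //; last by rewrite mE divfK// gt_eqF// mulr_gt0.
split=> //; split=> //; apply: (dK (sgK i)); first exact: (realization_supp0 K sx).
apply/fintype.subsetP => u; rewrite in_supp; apply: contraR => us.
by rewrite /x sphere_to_facet_out.
Qed.

Lemma sphere_to_facetK i x : realization_set K x -> 0 < m i x ->
  facet_to_sphere i x ord0 != 1 /\
  sphere_to_facet i (facet_to_sphere i x) = x.
Proof.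
move=> Kx mx; have r0 := rad_gt0 i Kx; have sx := facet_sum Kx mx.
set w := facet_to_sphere i x; set N := rad i x + m i x ^+ 2 in r0.
have N0 : N != 0 by rewrite gt_eqF.
have w0 : 1 - w ord0 = 2 * m i x ^+ 2 / N.
  by rewrite /w /facet_to_sphere/= -/N /N; field.
have w1 : w ord0 != 1.
  apply/eqP => w1; move: w0; rewrite w1 subrr => /esym/eqP.
  by rewrite mulf_eq0 invr_eq0 (negbTE N0) orbF mulf_eq0 pnatr_eq0/= sqrf_eq0 gt_eqF.
split=> //.
(* The displacement from the barycentre is recovered up to a positive factor; minima commute with
   such a factor, so it cancels against [den]. *)
have tE k : sum0_coord w k = 2 * m i x / N * (x (e i k) - 4^-1).
  move: k; apply: forall4; rewrite /sum0_coord/w/facet_to_sphere/= -/N.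
  - have -> : x (e i ord0) = 1 - x (e i o1) - x (e i o2) - x (e i o3) by rewrite -sx; ring.
    by field.
  - by field.
  - by field.
  - by field.
have c0 : 0 < 2 * m i x / N by rewrite divr_gt0 ?mulr_gt0.
have eE : eta w = 2 * m i x / N * (m i x - 4^-1).
  apply/eqP; rewrite eq_le; apply/andP; split.
    have [k mk] := m_attained i Kx.
    by rewrite [X in _ * (X - _)]mk -tE; exact: eta_le.
  have [k ->] := eta_attained w; rewrite tE ler_pM2l// lerD2r; exact: m_le.
have dE : den w = m i x / (2 * N).
  by rewrite /den w0 eE; field.
apply/funext => u; have [us|us] := boolP (u \in sg i); last first.
  rewrite sphere_to_facet_out//; apply/esym/eqP; move: us.
  by rewrite -(facet_supp Kx mx) in_supp negbK.
have [k ->] := e_surj us; rewrite sphere_to_facet_e tE dE.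
by field; rewrite N0 gt_eqF.
Qed.

Lemma cts_sphere_to_facet {X : topologicalType} (f : X -> {ptws 'I_4 -> R}) z i :
  sphere3_set (f z) -> f z ord0 != 1 -> {for z, continuous f} ->
  {for z, continuous (fun y => sphere_to_facet i (f y))}.
Proof.
move=> sz z1 cf; have ck k : {for z, continuous (fun y => f y k)} by exact: cts_coord.
have ct k : {for z, continuous (fun y => sum0_coord (f y) k)}.
  rewrite /sum0_coord; case: (k == ord0); last exact: ck.
  by apply: cts_N; do !apply: cts_D.
have cd : {for z, continuous (fun y => den (f y))}.
  apply: cts_D; first by apply: cts_D; [exact: cts_cst|apply: cts_N].
  by apply: cts_N; do !apply: cts_min.
apply: cts_ptws => u; apply: cts_sum => k _; apply: cts_M; first exact: cts_cst.
apply: cts_D; first exact: cts_cst.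
apply: cts_M => //; apply: cts_V.
  by rewrite gt_eqF// mulr_gt0//; exact: den_gt0.
by apply: cts_M => //; exact: cts_cst.
Qed.

(** Near the pole [1 - w ord0] is quadratic in the other coordinates while [eta] is of first order.
    Four numbers of sum 0, all at least [eta w], are at most [-3 eta w] in absolute value; with the
    bound 1/27 each square is at most [- eta w / 9], and [1 - w ord0 <= 1 - w ord0 ^+ 2]. *)
Lemma near_north_bound w : sphere3_set w -> 0 < w ord0 ->
  (forall k, k != ord0 -> `|w k| < 27^-1) -> 3 * (1 - w ord0) <= - eta w.
Proof.
move=> /sphere3E sw w0 h.
have := eta_le w ord0; have := eta_le w o1; have := eta_le w o2; have := eta_le w o3.
rewrite /sum0_coord/= => e3 e2 e1 e0.
have n1 := h o1 isT; have n2 := h o2 isT; have n3 := h o3 isT.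
move: n1 n2 n3; rewrite !ltr_norml => /andP[a1 b1] /andP[a2 b2] /andP[a3 b3].
have q1 : w o1 ^+ 2 <= - eta w / 9 by nra.
have q2 : w o2 ^+ 2 <= - eta w / 9 by nra.
have q3 : w o3 ^+ 2 <= - eta w / 9 by nra.
nra.
Qed.

(** Here [den w >= 4 (1 - w ord0)], hence the least coordinate is at most 1/16, the range in which
    the excess at time 1 is at least 1 and [c] has finished. *)
Lemma deform_near_north i w : sphere3_set w -> w ord0 != 1 ->
  3 * (1 - w ord0) <= - eta w ->
  realization_set deleted (stretch (sphere_to_facet i w, 1)) /\
  deform (sphere_to_facet i w, 1) = vertex p.
Proof.
move=> sw w1 h; have [Kx m0 mE] := sphere_to_facetP i sw w1.
have d0 := den_gt0 sw w1.
have m16 : m i (sphere_to_facet i w) <= 16^-1.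
  have : 4 * (1 - w ord0) <= den w by rewrite /den; lra.
  rewrite -mE; nra.
have K0 : realization_set deleted (stretch (sphere_to_facet i w, 1)).
  by apply: (stretch_deleted (i := i)) => //; [rewrite ler01 lexx|lra].
by split=> //; rewrite /deform c_ge1// (excess_facet _ Kx m0); lra.
Qed.

(** Dilation about the barycentre preserves directions, so the last three coordinates stay on their
    ray; this is what excludes antipodes. *)
Lemma facet_stretch_dir i w : sphere3_set w -> w ord0 != 1 ->
  exists2 a : R, 0 <= a & forall k, k != ord0 ->
    facet_to_sphere i (stretch (sphere_to_facet i w, 1)) k = a * w k.
Proof.
move=> sw w1; have [Kx m0 mE] := sphere_to_facetP i sw w1.
set x := sphere_to_facet i w in Kx m0 mE *.
have KE := stretch_realization ler01 Kx; have r0 := rad_gt0 i KE.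
have [l0 _] := lam_bounds ler01 (ltW m0); have d0 := den_gt0 sw w1.
set N := rad i _ + _ in r0; have [E0 _] := KE.
exists (2 * m i (stretch (x, 1)) * (1 + lam 1 (m i x)) / (4 * den w) / N).
  rewrite !divr_ge0 ?(ltW r0)// ?mulr_ge0 ?(ltW d0)// ?addr_ge0//.
  exact: mincoord_ge0.
move=> k k0; rewrite /facet_to_sphere (negbTE k0) -/N.
rewrite (stretch_facet _ ler01 Kx m0) /bary e_in /x sphere_to_facet_e.
rewrite /sum0_coord (negbTE k0) -/x.
by field; rewrite !gt_eqF.
Qed.

(** * Maps between the realization and the wedge *)

Definition base_point : realization R K :=
  exist _ (vertex p) (mem_set (deletedW vertex_deleted)).

Definition to_realization : {ptws V -> R} -> realization R K :=
  to_subset base_point.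

Lemma to_realizationE x : realization_set K x -> set_val (to_realization x) = x.
Proof. exact: to_subsetE. Qed.

Lemma set_val_realization (x : realization R K) : realization_set K (set_val x).
Proof. exact: set_valP. Qed.

Lemma to_realizationK (x : realization R K) : to_realization (set_val x) = x.
Proof. by apply: set_val_inj; rewrite to_realizationE//; exact: set_val_realization. Qed.

Definition inw i : sphere3 R -> wedge_S3 R nu :=
  @wedge_lift 'I_nu (fun=> sphere3 R) (fun=> north R) i.

Lemma inw_north i j : inw i (north R) = inw j (north R).
Proof. exact: (@wedge_liftE 'I_nu (fun=> sphere3 R) (fun=> north R) _ (north R) _ (north R)). Qed.

Lemma inw_continuous i : continuous (inw i).
Proof. exact: (@wedge_lift_continuous 'I_nu (fun=> sphere3 R) (fun=> north R)). Qed.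

Context (i0 : 'I_nu).

(** The [pick] involves no choice, since at most one open facet contains [x]; [i0] merely names the
    common base point. *)
Definition collapse_map (x : realization R K) : wedge_S3 R nu :=
  if [pick i | 0 < m i (set_val x)] is Some i
  then inw i (sph (facet_to_sphere i (set_val x))) else inw i0 (north R).

Lemma collapse_mapE i (x : realization R K) :
  (forall j, j != i -> m j (set_val x) = 0) ->
  collapse_map x = inw i (sph (facet_to_sphere i (set_val x))).
Proof.
move=> h; have Kx := set_val_realization x; rewrite /collapse_map.
case: pickP => [j mj|mN].
  suff -> : j = i by [].
  by apply/eqP; apply: contraLR mj => /h ->; rewrite ltxx.
rewrite facet_to_sphere_north ?sph_north//; first exact: inw_north.
have [[j mj _]|//] := facet_case Kx; by move: (mN j); rewrite mj.
Qed.

Lemma collapse_map_deleted i (x : realization R K) :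
  realization_set deleted (set_val x) -> collapse_map x = inw i (north R).
Proof.
move=> K0x; have Kx := set_val_realization x; have mx := (deletedP Kx).1 K0x.
by rewrite (@collapse_mapE i)// facet_to_sphere_north ?sph_north.
Qed.

Lemma collapse_map_exists (x : realization R K) :
  exists i, collapse_map x = inw i (sph (facet_to_sphere i (set_val x))).
Proof.
have [[i _ h]|h] := facet_case (set_val_realization x).
  by exists i; exact: collapse_mapE.
by exists i0; apply: collapse_mapE => j _.
Qed.

Lemma facet_map_continuous i :
  continuous (fun x : realization R K => inw i (sph (facet_to_sphere i (set_val x)))).
Proof.
move=> x; apply: (@continuous_comp _ _ _
  (fun x : realization R K => sph (facet_to_sphere i (set_val x))) (inw i));
  last exact: inw_continuous.
apply: cts_sub; apply: (@eq_cts _ _ (fun x : realization R K =>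
    facet_to_sphere i (set_val x))).
  by move=> y; rewrite sphE//; apply/facet_to_sphereP/set_val_realization.
apply: cts_facet_to_sphere; first exact: set_val_realization.
exact: set_val_continuous.
Qed.

(** Each value is given by one of finitely many continuous maps. On the deleted subcomplex all of
    them take the base value, so their neighbourhoods can be intersected; inside an open facet a
    single one applies nearby. *)
Lemma collapse_map_continuous : continuous collapse_map.
Proof.
move=> x U; have [K0x|K0x] := pselect (realization_set deleted (set_val x)).
  rewrite (collapse_map_deleted i0 K0x) => nU.
  have Kx := set_val_realization x; have mx := (deletedP Kx).1 K0x.
  have H i : \forall y \near x, U (inw i (sph (facet_to_sphere i (set_val y)))).
    apply: (@facet_map_continuous i x).
    by rewrite facet_to_sphere_north// sph_north (inw_north i i0).
  have : \forall y \near x, forall i, U (inw i (sph (facet_to_sphere i (set_val y)))).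
    exact: near_finite_all.
  by apply: filterS => y Uy /=; have [i yE] := collapse_map_exists y; rewrite /= yE.
have Kx := set_val_realization x.
have [[i mi h]|mx] := facet_case Kx; last by case: K0x; exact/(deletedP Kx).
rewrite (collapse_mapE h) => nU.
have cm : {for x, continuous (fun y : realization R K => m i (set_val y))}.
  by apply: cts_m; exact: set_val_continuous.
have near1 : \forall y \near x, 0 < m i (set_val y) by exact: (cvgr_gt _ cm).
have near2 := facet_map_continuous nU.
apply: filterS2 near1 near2 => y my /= Uy.
rewrite /= (@collapse_mapE i)// => j ji.
exact: (facet_unique (set_val_realization y) my).
Qed.

Definition sphere_map i (w : sphere3 R) : realization R K :=
  if set_val w ord0 == 1 then base_point
  else to_realization (deform (sphere_to_facet i (set_val w), 1)).

Lemma near_north : \forall w \near north R,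
  0 < set_val w ord0 /\ (forall k, k != ord0 -> `|set_val w k| < 27^-1).
Proof.
have cw k : {for north R, continuous (fun w : sphere3 R => set_val w k)}.
  by apply: cts_coord; exact: set_val_continuous.
have H0 : \forall w \near north R, 0 < set_val w ord0.
  apply: (cvgr_gt _ (cw ord0)).
  by rewrite set_valE /= /north_pt ltr01.
have H k : \forall w \near north R, k != ord0 -> `|set_val w k| < 27^-1.
  have [->|k0] := eqVneq k ord0; first by apply: filterS H0.
  have z : set_val (north R) k = 0 by rewrite set_valE/= /north_pt (negbTE k0).
  have /cvgr0_norm_lt H1 : (fun w : sphere3 R => set_val w k) @ north R --> (0 : R).
    by rewrite -z; exact: cw.
  by apply: filterS (H1 27^-1 _) => [w //|]; rewrite invr_gt0.
have : \forall w \near north R, forall k, k != ord0 -> `|set_val w k| < 27^-1.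
  exact: near_finite_all.
by apply: filterS2 H0 => w.
Qed.

(** By [near_north_bound] the second hypothesis makes [g] constant in a punctured neighbourhood of
    the pole, so the pole can be filled in. *)
Lemma sphere_piecewise_continuous {Z : topologicalType} (z : Z)
  (g : sphere3 R -> Z) :
  (forall w : sphere3 R, set_val w ord0 != 1 -> {for w, continuous g}) ->
  (forall w : sphere3 R, set_val w ord0 != 1 ->
    3 * (1 - set_val w ord0) <= - eta (set_val w) -> g w = z) ->
  continuous (fun w : sphere3 R => if set_val w ord0 == 1 then z else g w).
Proof.
move=> cg gz w; have [w1|w1] := eqVneq (set_val w ord0) 1.
  rewrite (sphere3_eq_north w1) => U /=; rewrite set_valE/= /north_pt !eqxx => nU.
  apply: filterS near_north => w' [w'0 h] /=; case: eqVneq => [_|w'1].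
    exact: (nbhs_singleton nU).
  rewrite gz//; first exact: (nbhs_singleton nU).
  by apply: near_north_bound => //; exact: set_val_sphere.
rewrite /continuous_at (negbTE w1).
have cw : {for w, continuous (fun w : sphere3 R => set_val w ord0)}.
  by apply: cts_coord; exact: set_val_continuous.
have nw : \forall w' \near w, set_val w' ord0 < 1.
  by apply: (cvgr_lt _ cw); rewrite lt_neqAle w1 sphere_le1//; exact: set_val_sphere.
move=> U nU; have := cg w w1 U nU; apply: filterS2 nw => w' w'1 /=.
by rewrite lt_eqF.
Qed.

Lemma cts_stretched i (w : sphere3 R) : set_val w ord0 != 1 ->
  {for w, continuous (fun w : sphere3 R => (sphere_to_facet i (set_val w), 1 : R))}.
Proof.
move=> w1; apply: cts_pair; last exact: (@cts_cst R).
apply: cts_sphere_to_facet w1 _; first exact: set_val_sphere.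
exact: set_val_continuous.
Qed.

Lemma deform1_realization x : realization_set K x -> realization_set K (deform (x, 1)).
Proof. by move=> Kx; apply: deform_realization => //; rewrite ler01 lexx. Qed.

Lemma sphere_map_continuous i : continuous (sphere_map i).
Proof.
apply: sphere_piecewise_continuous => w w1; last first.
  move=> h; have [_ ->] := deform_near_north i (set_val_sphere w) w1 h.
  exact: (to_realizationK base_point).
have cw : {for w, continuous (fun w : sphere3 R => set_val w ord0)}.
  by apply: cts_coord; exact: set_val_continuous.
have nw : \forall w' \near w, set_val w' ord0 < 1.
  by apply: (cvgr_lt _ cw); rewrite lt_neqAle w1 sphere_le1//; exact: set_val_sphere.
have Kw (w' : sphere3 R) : set_val w' ord0 != 1 ->
    realization_set K (deform (sphere_to_facet i (set_val w'), 1)).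
  move=> w'1; apply: deform1_realization.
  by have [] := sphere_to_facetP i (set_val_sphere w') w'1.
apply: cts_sub => U; rewrite to_realizationE; last exact: Kw.
move=> nU; have cd : {for w, continuous (fun w : sphere3 R =>
    deform (sphere_to_facet i (set_val w), 1))}.
  apply: (@continuous_comp _ _ _ (fun w : sphere3 R =>
    (sphere_to_facet i (set_val w), 1 : R)) deform); last exact: deform_continuous.
  exact: cts_stretched.
have := cd U nU; apply: filterS2 nw => w' w'1 /=.
by rewrite to_realizationE//; apply: Kw; rewrite lt_eqF.
Qed.

Lemma sphere_map_north i : sphere_map i (north R) = base_point.
Proof. by rewrite /sphere_map set_valE/= /north_pt !eqxx. Qed.

Definition expand_map : wedge_S3 R nu -> realization R K :=
  @wedge_fun 'I_nu (fun=> sphere3 R) (fun=> north R) _ sphere_map.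

Lemma expand_map_continuous : continuous expand_map.
Proof.
apply: wedge_fun_continuous; first exact: sphere_map_continuous.
by move=> i j; rewrite !sphere_map_north.
Qed.

Lemma expand_mapE i (w : sphere3 R) : expand_map (inw i w) = sphere_map i w.
Proof. by apply: wedge_lift_funE => a b; rewrite !sphere_map_north. Qed.

Lemma expand_collapse (x : realization R K) :
  expand_map (collapse_map x) = to_realization (deform (set_val x, 1)).
Proof.
have Kx := set_val_realization x; have [[i mi h]|mx] := facet_case Kx.
  rewrite (collapse_mapE h) expand_mapE /sphere_map sphE; last exact: facet_to_sphereP.
  by have [w1 ->] := sphere_to_facetK Kx mi; rewrite (negbTE w1).
have K0x := (deletedP Kx).2 mx.
rewrite (collapse_map_deleted i0 K0x) expand_mapE sphere_map_north.
by rewrite deform1_deleted//; exact/esym/(to_realizationK base_point).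
Qed.

Lemma expand_collapse_homotopic : homotopic R (expand_map \o collapse_map) idfun.
Proof.
(* Time is reversed because [deform] starts, rather than ends, at the identity. *)
exists (fun q => to_realization (deform (set_val q.1, 1 - clamp q.2))).
have t01 (t : R) : 0 <= 1 - clamp t <= 1 by have := clamp_itv t; lra.
split; [|split].
- apply: continuous_subspaceT => q; apply: cts_sub.
  apply: (@eq_cts _ _ (fun q : realization R K * R =>
      deform (set_val q.1, 1 - clamp q.2))).
    move=> q'; rewrite to_realizationE//; apply: deform_realization => //.
    exact: set_val_realization.
  apply: (@continuous_comp _ _ _ (fun q : realization R K * R =>
    (set_val q.1, 1 - clamp q.2)) deform); last exact: deform_continuous.
  apply: cts_pair; first by apply: cts_val; exact: cvg_fst.
  apply: cts_D; [exact: cts_cst|apply: cts_N; apply: cts_max; first exact: cts_cst].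
  by apply: cts_min; [exact: cts_cst|exact: cvg_snd].
- by move=> x /=; rewrite clamp_le0// subr0 expand_collapse.
- move=> x /=; rewrite clamp_ge1// subrr deform0 ?to_realizationK//.
  exact: set_val_realization.
Qed.

(** The composite of the two maps on one summand. The contraction is absent: it acts only inside the
    deleted subcomplex, all of which goes to the base point. *)
Definition sphere_self i (w : sphere3 R) : sphere3 R :=
  if set_val w ord0 == 1 then north R
  else sph (facet_to_sphere i (stretch (sphere_to_facet i (set_val w), 1))).

Lemma stretch1_realization i (w : sphere3 R) : set_val w ord0 != 1 ->
  realization_set K (stretch (sphere_to_facet i (set_val w), 1)).
Proof.
move=> w1; apply: stretch_realization => //.
by have [] := sphere_to_facetP i (set_val_sphere w) w1.
Qed.

Lemma sphere_self_continuous i : continuous (sphere_self i).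
Proof.
apply: sphere_piecewise_continuous => w w1; last first.
  move=> h; have [K0 _] := deform_near_north i (set_val_sphere w) w1 h.
  have Kx := deletedW K0; rewrite facet_to_sphere_north ?sph_north//.
  exact: (deletedP Kx).1.
have cw : {for w, continuous (fun w : sphere3 R => set_val w ord0)}.
  by apply: cts_coord; exact: set_val_continuous.
have nw : \forall w' \near w, set_val w' ord0 < 1.
  by apply: (cvgr_lt _ cw); rewrite lt_neqAle w1 sphere_le1//; exact: set_val_sphere.
have Kw (w' : sphere3 R) : set_val w' ord0 != 1 -> sphere3_set
    (facet_to_sphere i (stretch (sphere_to_facet i (set_val w'), 1))).
  by move=> w'1; apply/facet_to_sphereP/stretch1_realization.
apply: cts_sub => U; rewrite sphE; last exact: Kw.
move=> nU; have cd : {for w, continuous (fun w : sphere3 R =>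
    facet_to_sphere i (stretch (sphere_to_facet i (set_val w), 1)))}.
  apply: cts_facet_to_sphere; first exact: stretch1_realization.
  apply: (@continuous_comp _ _ _ (fun w : sphere3 R =>
    (sphere_to_facet i (set_val w), 1 : R)) stretch); last exact: stretch_continuous.
  exact: cts_stretched.
have := cd U nU; apply: filterS2 nw => w' w'1 /=.
by rewrite sphE//; apply: Kw; rewrite lt_eqF.
Qed.

(** By [facet_stretch_dir] an antipodal value forces the last three coordinates to vanish. The north
    pole is fixed, and the south pole corresponds to the barycentre, which dilation fixes. *)
Lemma sphere_self_antipode i (w : sphere3 R) :
  exists k, set_val (sphere_self i w) k != - set_val w k.
Proof.
rewrite /sphere_self; have sw := set_val_sphere w.
have [w1|w1] := eqVneq (set_val w ord0) 1.
  by exists ord0; rewrite w1 set_valE/= /north_pt eqxx; apply/eqP => h; lra.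
have Kx := stretch1_realization i w1; rewrite sphE; last exact: facet_to_sphereP.
apply: contrapT => /forallNP h.
have {}h k : facet_to_sphere i (stretch (sphere_to_facet i (set_val w), 1)) k =
    - set_val w k by apply/eqP; apply: contrapT => /negP/h.
have [a a0 ha] := facet_stretch_dir i sw w1.
have z k : k != ord0 -> set_val w k = 0.
  move=> k0; apply/eqP; have := ha k k0; rewrite h => /eqP.
  rewrite eq_sym -subr_eq0 opprK -[X in _ + X]mul1r -mulrDl mulf_eq0.
  by rewrite gt_eqF// ltr_wpDl.
have z1 := z o1 isT; have z2 := z o2 isT; have z3 := z o3 isT.
have w0 : set_val w ord0 = -1.
  have := sphere3E sw; rewrite z1 z2 z3 !expr0n !addr0 => /eqP.
  by rewrite sqrf_eq1 (negbTE w1) => /eqP.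
have [Kw m0 _] := sphere_to_facetP i sw w1.
have xe k : stretch (sphere_to_facet i (set_val w), 1) (e i k) = 4^-1.
  rewrite (stretch_facet _ ler01 Kw m0) /bary e_in sphere_to_facet_e.
  have -> : sum0_coord (set_val w) k = 0.
    by rewrite /sum0_coord z1 z2 z3 !addr0 oppr0; case: eqVneq => // /z.
  by rewrite mul0r addr0 subrr mulr0 addr0.
have mE : m i (stretch (sphere_to_facet i (set_val w), 1)) = 4^-1.
  by apply: m_eq => [k||]; [rewrite xe|exists ord0; rewrite xe|lra].
have := h ord0; rewrite w0 /facet_to_sphere/= /rad !xe mE => h0.
have : (1 : R) = -1; last by move=> ?; lra.
by rewrite opprK in h0; rewrite -[LHS]h0; field.
Qed.

Lemma collapse_expand i (w : sphere3 R) :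
  collapse_map (expand_map (inw i w)) = inw i (sphere_self i w).
Proof.
rewrite expand_mapE /sphere_map /sphere_self; have sw := set_val_sphere w.
have [w1|w1] := eqVneq (set_val w ord0) 1.
  apply: collapse_map_deleted; rewrite set_valE/=; exact: vertex_deleted.
have [Kx m0 _] := sphere_to_facetP i sw w1; set x := sphere_to_facet i _ in Kx m0 *.
have KE := stretch_realization ler01 Kx.
have KG := deform1_realization Kx.
have [h|h] := leP (excess (x, 1)) 0.
  rewrite (@collapse_mapE i) to_realizationE//.
    by rewrite /deform c_le0.
  rewrite /deform c_le0// => j ji.
  have [[l ml hl]|//] := facet_case KE.
  suff il : l = i by apply: hl; rewrite il.
  apply/esym/sg_inj/sg_facet => //.
  by rewrite -(facet_supp KE ml) (stretch_supp ler01 Kx m0).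
have K0 : realization_set deleted (stretch (x, 1)).
  apply: (stretch_deleted _ Kx m0); first by rewrite ler01 lexx.
  by move: h; rewrite (excess_facet _ Kx m0); lra.
rewrite (@collapse_map_deleted i) ?to_realizationE//; last exact: cK0.
by rewrite facet_to_sphere_north ?sph_north//; exact: (deletedP KE).1.
Qed.

Lemma inw_surj (z : wedge_S3 R nu) : exists i (w : sphere3 R), z = inw i w.
Proof.
have : [set: wedge_S3 R nu] z by [].
by rewrite -wedgeTE => -[i _ [w _ <-]]; exists i, w.
Qed.

Lemma sphere_self_north i : sphere_self i (north R) = north R.
Proof. by rewrite /sphere_self set_valE/= /north_pt !eqxx. Qed.

Lemma collapse_expand_homotopic : homotopic R (collapse_map \o expand_map) idfun.
Proof.
have hP i := slerp_homotopic (@sphere_self_continuous i)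
  (@sphere_self_antipode i) (sphere_self_north i).
pose h i := projT1 (cid (hP i)).
have hc i : continuous (uncurry (h i)) by rewrite /h; case: cid => ? [].
have h0 i (w : sphere3 R) : h i 0 w = sphere_self i w by rewrite /h; case: cid => ? [].
have h1 i (w : sphere3 R) : h i 1 w = w by rewrite /h; case: cid => ? [].
have hn i t : h i t (north R) = north R by rewrite /h; case: cid => ? [].
pose H t := @wedge_fun 'I_nu (fun=> sphere3 R) (fun=> north R) _
  (fun i (w : sphere3 R) => inw i (h i t w)).
have hE t i j : inw i (h i t (north R)) = inw j (h j t (north R)).
  by rewrite !hn; exact: inw_north.
have HE t i (w : sphere3 R) : H t (inw i w) = inw i (h i t w) by exact: wedge_lift_funE.
(* Continuity jointly in time and point, stronger than that of each [H t], rests on the finite index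
   set and the closed base point. *)
have Hc : continuous (uncurry H).
  apply: (@wedge_fun_joint_continuous 'I_nu (fun=> sphere3 R) (fun=> north R)
    R (wedge_S3 R nu) (fun i t (w : sphere3 R) => inw i (h i t w))).
  - exact: finite_finset.
  - by move=> _; exact: closed_north.
  - by move=> t i j; exact: hE.
  - move=> i /=; rewrite (_ : uncurry _ = inw i \o uncurry (h i)); last first.
      by apply/funext => -[].
    move=> q; apply: continuous_comp; [exact: hc|exact: inw_continuous].
exists (fun q => uncurry H (q.2, q.1)); split; [|split].
- apply: continuous_subspaceT => q.
  apply: (@continuous_comp _ _ _ (fun q : wedge_S3 R nu * R => (q.2, q.1))
    (uncurry H)); last exact: Hc.
  by apply: cts_pair; [exact: cvg_snd|exact: cvg_fst].
- by move=> z; have [i [w ->]] := inw_surj z; rewrite /= HE h0 collapse_expand.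
- by move=> z; have [i [w ->]] := inw_surj z; rewrite /= HE h1.
Qed.

Lemma realization_wedge : homotopy_equivalent R (realization R K) (wedge_S3 R nu).
Proof.
exists collapse_map, expand_map; split; first exact: collapse_map_continuous.
split; first exact: expand_map_continuous.
by split; [exact: expand_collapse_homotopic|exact: collapse_expand_homotopic].
Qed.
End Facets.

Lemma homotopy_equivalent_wedge (R : realType) (V : finType)
  (K : {set V} -> bool) (T : {set {set V}}) (p : V) : down_closed K ->
  (forall s, s \in T -> [/\ #|s| = 4%N, K s &
     forall s', K s' -> s \subset s' -> s' = s]) ->
  K (finset.set1 p) -> T != finset.set0 ->
  @contractible R V (fun s => K s && (s \notin T)) p ->
  homotopy_equivalent R (realization R K) (wedge_S3 R #|T|).
Proof.
move=> dK TP Kp /set0Pn[t Tt] [c [cc c0 cK c1]].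
pose sg (i : 'I_#|T|) : {set V} := enum_val i.
have sgT i : sg i \in T by exact: enum_valP.
have E : (fun s => K s && (s \notin T)) = deleted K sg.
  apply/funext => s; rewrite /deleted; congr (_ && _); apply/idP/forallP => h.
    by move=> i; apply: contra h => /eqP ->.
  by apply/negP => sT; have := h (enum_rank_in sT s); rewrite /sg enum_rankK_in ?eqxx.
rewrite {}E in cK c1.
have sg_card i : #|sg i| = 4%N by have [] := TP _ (sgT i).
have K0p : deleted K sg (finset.set1 p).
  rewrite /deleted Kp; apply/forallP => i; apply: contra_eq_neq (sg_card i) => <-.
  by rewrite cards1.
apply: (@realization_wedge R V K _ sg p _ sg_card _ _ dK K0p c cc c0 cK c1).
- exact: enum_val_inj.
- by move=> i s Ks si; have [_ _ h] := TP _ (sgT i); exact: h.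
- by move=> i; have [] := TP _ (sgT i).
- by exact: (enum_rank_in Tt t).
Qed.

(** * Collapsing the Vietoris-Rips complex *)

Section GridGeometry.
Context {n m : nat}.
Implicit Types (x y z : grid n m) (i j k l : 'I_n) (r : seq 'I_n).

(** [dn] truncates at 0 like subtraction on [nat], so [dnE] is unconditional; [up] is meaningful
    only below [m]. *)
Definition dn x i : grid n m := [ffun l => if l == i then inord (x l).-1 else x l].
Definition up x i : grid n m := [ffun l => if l == i then inord (x l).+1 else x l].

Lemma dnE x i l : (dn x i l : nat) = (x l - (l == i))%N.
Proof.
rewrite ffunE; case: eqP => _; last by rewrite subn0.
by rewrite inordK ?subn1// (leq_ltn_trans (leq_pred _))//; exact: ltn_ord.
Qed.

Lemma upE x i l : (x i < m)%N -> (up x i l : nat) = (x l + (l == i))%N.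
Proof.
by move=> xi; rewrite ffunE; case: eqP => [->|_]; rewrite ?addn0// inordK ?addn1.
Qed.

Definition agree r y x : Prop := forall l, l \notin r -> y l = x l.

Lemma agree_refl r x : agree r x x. Proof. by []. Qed.
Arguments agree_refl : clear implicits.

Lemma agree_dn r y x i : agree r y x -> i \in r -> agree r (dn y i) x.
Proof.
move=> yx ir l lr; rewrite ffunE -yx//; case: eqP => // li.
by rewrite li ir in lr.
Qed.

Lemma agree_up r y x i : agree r y x -> i \in r -> agree r (up y i) x.
Proof.
move=> yx ir l lr; rewrite ffunE -yx//; case: eqP => // li.
by rewrite li ir in lr.
Qed.

(** Distance arguments name up to three coordinates and lump all others into this one number, so
    that linear arithmetic settles them. *)
Definition rest r y x : nat :=
  (\sum_(l | l \notin r) `|(y l : nat) - (x l : nat)|)%N.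

Lemma manhattan_split r y z x : uniq r -> agree r z x -> manhattan y z =
  (\sum_(l <- r) `|(y l : nat) - (z l : nat)| + rest r y x)%N.
Proof.
move=> ur zx; rewrite /manhattan (bigID (mem r))/= -big_uniq//=; congr addn.
by apply: eq_bigr => l lr; rewrite zx.
Qed.

Lemma eq_on r y z x : rest r y x = 0%N -> agree r z x ->
  (forall l, l \in r -> y l = z l :> nat) -> y = z.
Proof.
move=> /eqP; rewrite sum_nat_eq0 => /forall_inP yx zx yz.
apply/ffunP => l; have [lr|lr] := boolP (l \in r); first exact/val_inj/yz.
by apply: val_inj; have := yx l lr; rewrite zx//=; lia.
Qed.

Lemma manhattanxx x : manhattan x x = 0%N.
Proof. by rewrite /manhattan big1// => l _; rewrite subrr. Qed.

Lemma manhattanC x y : manhattan x y = manhattan y x.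
Proof. by apply: eq_bigr => l _; lia. Qed.

(* The weights decrease along the coordinates, so that within distance 2 the
   points of smaller weight are exactly the lexicographically smaller ones. *)
Definition weight x : nat := (\sum_(l < n) (n - l) * x l)%N.

Lemma weight_split r y x : uniq r -> agree r y x ->
  (weight y + \sum_(l <- r) (n - l) * x l = weight x + \sum_(l <- r) (n - l) * y l)%N.
Proof.
move=> ur yx.
have W z : weight z = (\sum_(l <- r) (n - l) * z l + \sum_(l < n | l \notin r) (n - l) * z l)%N.
  by rewrite /weight (bigID (mem r))/= big_uniq.
have E : (\sum_(l < n | l \notin r) (n - l) * y l = \sum_(l < n | l \notin r) (n - l) * x l)%N.
  by apply: eq_bigr => l lr; rewrite yx.
by rewrite !W E; lia.
Qed.

Lemma weight_dn x i : (0 < x i)%N -> (weight (dn x i) < weight x)%N.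
Proof.
move=> xi; have := @weight_split [:: i] (dn x i) x isT.
rewrite !big_cons !big_nil dnE eqxx; have := ltn_ord i.
by move=> ? /(_ (agree_dn (agree_refl _ x) (mem_head _ _))); nia.
Qed.

Lemma weight_dn_up x i j : (0 < x i)%N -> (x j < m)%N -> (i < j)%N ->
  (weight (up (dn x i) j) < weight x)%N.
Proof.
move=> xi xj ij; have ji : (j == i) = false by rewrite -val_eqE/= gtn_eqF.
have ij' : (i == j) = false by rewrite eq_sym.
have u : uniq [:: i; j] by rewrite /= inE ij'.
have ag : agree [:: i; j] (up (dn x i) j) x.
  by apply: agree_up; [apply: agree_dn; rewrite ?inE ?eqxx|rewrite !inE eqxx orbT].
have := weight_split u ag; rewrite !big_cons !big_nil.
have xj' : (dn x i j < m)%N by rewrite dnE ji subn0.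
rewrite !upE// !dnE !eqxx ij' ji.
by have := ltn_ord i; have := ltn_ord j; nia.
Qed.

(** An excess in one coordinate needs a drop in another, else [y] would be heavier. Together they
    exhaust the distance 2, and decreasing weights put the drop first. *)
Lemma dn_weight x y : (manhattan y x <= 2)%N -> (weight y <= weight x)%N ->
  forall i, (x i < y i)%N -> exists j,
  [/\ (j < i)%N, (0 < x j)%N, (x i < m)%N & y = up (dn x j) i].
Proof.
move=> yx wyx i xy; have xim : (x i < m)%N by have := ltn_ord (y i); lia.
have [j yj] : exists j, (y j < x j)%N.
  apply: contrapT => /forallNP h; have {}h l : (x l <= y l)%N.
    by rewrite leqNgt; apply/negP/h.
  have : (weight x < weight y)%N.
    rewrite /weight (bigD1 i)//= [X in (_ < X)%N](bigD1 i)//= -addSn.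
    apply: leq_add; last by apply: leq_sum => l _; rewrite leq_mul2l h orbT.
    by rewrite ltn_mul2l subn_gt0 ltn_ord.
  lia.
have ij : (i == j) = false by apply/eqP => ij; move: xy yj; rewrite ij; lia.
have ji : (j == i) = false by rewrite eq_sym.
have u : uniq [:: i; j] by rewrite /= inE ij.
have := @manhattan_split [:: i; j] y x x u (agree_refl _ x); rewrite !big_cons big_nil => E.
have r0 : rest [:: i; j] y x = 0%N by lia.
have yi : (y i : nat) = (x i).+1 by lia.
have xj0 : (0 < x j)%N by lia.
have yj' : (y j : nat) = (x j).-1 by lia.
have yE : y = up (dn x j) i.
  apply: (eq_on r0).
    by apply: agree_up; [apply: agree_dn|]; rewrite ?inE ?eqxx ?orbT.
  have xi' : (dn x j i < m)%N by rewrite dnE ij subn0.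
  by move=> l; rewrite !inE => /orP[]/eqP ->; rewrite upE// dnE eqxx ?ij ?ji; lia.
exists j; split=> //.
rewrite ltnNge; apply/negP => ij'; have ltij : (i < j)%N.
  by rewrite ltn_neqAle ij'; move/negbT: ij; rewrite -val_eqE => ->.
have ag : agree [:: i; j] y x.
  by rewrite yE; apply: agree_up; [apply: agree_dn|]; rewrite ?inE ?eqxx ?orbT.
have := weight_split u ag; rewrite !big_cons !big_nil yi yj'.
by have := ltn_ord j; nia.
Qed.

End GridGeometry.
Arguments agree_refl {n m} r x.


(** * The tetrahedra to be deleted *)

Section CriticalTetrahedra.
Context {n m : nat}.
Implicit Types (x y z : grid n m) (i j k l : 'I_n) (s : {set grid n m}).

Definition VR2 s : bool := VR_simplex 2 s.

Lemma VR2P s : reflect (s != finset.set0 /\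
  forall y z, y \in s -> z \in s -> (manhattan y z <= 2)%N) (VR2 s).
Proof.
rewrite /VR2/VR_simplex card_gt0; apply: (iffP andP) => -[s0 h]; split=> //.
  by move=> y z ys zs; move: h => /forall_inP/(_ y ys)/forall_inP/(_ z zs).
by apply/forall_inP => y ys; apply/forall_inP => z zs; exact: h.
Qed.

(* The two regular tetrahedra inscribed in a unit 3-cube are maximal simplices;
   [x] below is the vertex of largest weight.  Those lying below [x], and those
   that are constant up to and including some coordinate in which [x] does not
   vanish, are deleted. *)
Definition critical s : Prop :=
  [/\ #|s| = 4%N, (forall y z, y \in s -> z \in s -> y != z -> manhattan y z = 2%N),
      (forall y, (forall z, z \in s -> (manhattan y z <= 2)%N) -> y \in s) &
      exists2 x, x \in s & (forall y, y \in s -> (weight y <= weight x)%N) /\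
        ((forall y, y \in s -> forall l, (y l <= x l)%N) \/
         exists2 i, (0 < x i)%N & forall y, y \in s -> forall l, (l <= i)%N -> y l = x l)].

Definition tetrahedra : {set {set grid n m}} := finset (fun s => `[< critical s >]).

Lemma tetrahedraP s : s \in tetrahedra <-> critical s.
Proof. by rewrite inE; split=> [/asboolP|/asboolT]. Qed.

Lemma critical_VR2 s : critical s -> VR2 s.
Proof.
case=> s4 sd _ _; apply/VR2P; split; first by rewrite -cards_eq0 s4.
move=> y z ys zs; have [->|yz] := eqVneq y z; first by rewrite manhattanxx.
by rewrite sd.
Qed.

Lemma critical_facet s s' : critical s -> VR2 s' -> s \subset s' -> s' = s.
Proof.
move=> [_ _ smax _] /VR2P[_ s'd] /fintype.subsetP ss'; apply/eqP.
rewrite finset.eqEsubset; apply/andP; split; last exact/fintype.subsetP.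
by apply/fintype.subsetP => y ys'; apply: smax => z /ss' zs'; exact: s'd.
Qed.

(** The test by which most new simplices are seen not to be critical: two of their vertices are at
    distance 1. *)
Lemma critical_dist s y z : critical s -> y \in s -> z \in s -> manhattan y z != 1%N.
Proof.
case=> _ sd _ _ ys zs; have [->|yz] := eqVneq y z; first by rewrite manhattanxx.
by rewrite sd.
Qed.

Lemma down_closed_VR2 : down_closed VR2.
Proof.
move=> s s' /VR2P[_ sd] s'0 /fintype.subsetP ss'; apply/VR2P; split=> // y z ys zs.
by apply: sd; exact: ss'.
Qed.

Definition VR2_deleted s : bool := VR2 s && (s \notin tetrahedra).

Lemma down_closed_deleted : down_closed VR2_deleted.
Proof.
move=> s s' /andP[Ks sT] s'0 ss'; rewrite /VR2_deleted (down_closed_VR2 Ks)//=.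
apply: contra sT => s'T; suff -> : s = s' by [].
by apply: (critical_facet _ Ks ss'); exact/tetrahedraP.
Qed.

(** The points are alternate vertices of a unit cube. Allowing [c'] on either side of [c] covers
    both the tetrahedra below [x] and those that rise in the coordinate [k]. *)
Lemma tetrahedron_geometry (t0 t1 t2 t3 x : grid n m) i j k (a b c c' : nat) :
  uniq [:: i; j; k] -> agree [:: i; j; k] t0 x -> agree [:: i; j; k] t1 x ->
  agree [:: i; j; k] t2 x -> agree [:: i; j; k] t3 x ->
  (c' = c.+1 \/ c = c'.+1) ->
  [/\ t0 i = a.+1 :> nat, t0 j = b.+1 :> nat & t0 k = c :> nat] ->
  [/\ t1 i = a :> nat, t1 j = b :> nat & t1 k = c :> nat] ->
  [/\ t2 i = a :> nat, t2 j = b.+1 :> nat & t2 k = c' :> nat] ->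
  [/\ t3 i = a.+1 :> nat, t3 j = b :> nat & t3 k = c' :> nat] ->
  let s := [set t0; t1; t2; t3]%SET in
  [/\ #|s| = 4%N, (forall y z, y \in s -> z \in s -> y != z -> manhattan y z = 2%N) &
      (forall y, (forall z, z \in s -> (manhattan y z <= 2)%N) -> y \in s)].
Proof.
move=> u g0 g1 g2 g3 cc [a0 b0 c0] [a1 b1 c1] [a2 b2 c2] [a3 b3 c3] s.
have D y z : agree [:: i; j; k] z x -> manhattan y z =
    (`|(y i : nat) - (z i : nat)| + (`|(y j : nat) - (z j : nat)| +
     (`|(y k : nat) - (z k : nat)| + 0)) + rest [:: i; j; k] y x)%N.
  by move=> gz; rewrite (manhattan_split y u gz) !big_cons big_nil.
have r0 y : agree [:: i; j; k] y x -> rest [:: i; j; k] y x = 0%N.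
  by move=> gy; rewrite /rest big1// => l lr; rewrite gy// subrr.
have d01 : manhattan t0 t1 = 2%N by rewrite D// r0// a0 b0 c0 a1 b1 c1; lia.
have d02 : manhattan t0 t2 = 2%N by rewrite D// r0// a0 b0 c0 a2 b2 c2; lia.
have d03 : manhattan t0 t3 = 2%N by rewrite D// r0// a0 b0 c0 a3 b3 c3; lia.
have d12 : manhattan t1 t2 = 2%N by rewrite D// r0// a1 b1 c1 a2 b2 c2; lia.
have d13 : manhattan t1 t3 = 2%N by rewrite D// r0// a1 b1 c1 a3 b3 c3; lia.
have d23 : manhattan t2 t3 = 2%N by rewrite D// r0// a2 b2 c2 a3 b3 c3; lia.
have ne (y z : grid n m) : manhattan y z = 2%N -> (y == z) = false.
  by move=> d; apply/eqP => yz; move: d; rewrite yz manhattanxx.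
split.
- rewrite /s -!finset.setUA !finset.cardsU1 finset.cards1 !inE.
  by rewrite !ne.
- move=> y z; rewrite !inE -!orbA.
  move=> /or4P[]/eqP-> /or4P[]/eqP->; rewrite ?eqxx// => _; rewrite // manhattanC//.
- move=> y yd; have h0 := yd t0; have h1 := yd t1; have h2 := yd t2; have h3 := yd t3.
  rewrite !inE !eqxx ?orbT/= !D// in h0 h1 h2 h3.
  have {}h0 := h0 isT; have {}h1 := h1 isT.
  have {}h2 := h2 isT; have {}h3 := h3 isT.
  rewrite a0 b0 c0 in h0; rewrite a1 b1 c1 in h1.
  rewrite a2 b2 c2 in h2; rewrite a3 b3 c3 in h3.
  (* The four distances add up to at most 8. Each named coordinate contributes at least 2, and at
     least 6 when it leaves the cube, so [y] is a vertex of the cube; the other four vertices are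
     each at distance 3 from one of the [t]'s. *)
  have z0 : rest [:: i; j; k] y x = 0%N by lia.
  have E z : agree [:: i; j; k] z x -> y i = z i :> nat -> y j = z j :> nat ->
      y k = z k :> nat -> y == z.
    move=> gz yi yj yk; apply/eqP; apply: (eq_on z0 gz) => l.
    by rewrite !inE => /or3P[]/eqP->.
  have : [\/ [/\ y i = a.+1 :> nat, y j = b.+1 :> nat & y k = c :> nat],
    [/\ y i = a :> nat, y j = b :> nat & y k = c :> nat],
    [/\ y i = a :> nat, y j = b.+1 :> nat & y k = c' :> nat] |
    [/\ y i = a.+1 :> nat, y j = b :> nat & y k = c' :> nat]].
    have yi : (y i = a :> nat) \/ (y i = a.+1 :> nat) by lia.
    have yj : (y j = b :> nat) \/ (y j = b.+1 :> nat) by lia.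
    have yk : (y k = c :> nat) \/ (y k = c' :> nat) by lia.
    case: yi yj yk => [yi|yi] [yj|yj] [yk|yk]; rewrite yi yj yk in h0 h1 h2 h3 *;
      first [by constructor 1|by constructor 2|by constructor 3|by constructor 4|exfalso; lia].
  rewrite !inE -!orbA => -[][yi yj yk]; apply/or4P.
  + by constructor 1; apply: E => //; rewrite ?yi ?yj ?yk.
  + by constructor 2; apply: E => //; rewrite ?yi ?yj ?yk.
  + by constructor 3; apply: E => //; rewrite ?yi ?yj ?yk.
  + by constructor 4; apply: E => //; rewrite ?yi ?yj ?yk.
Qed.

End CriticalTetrahedra.

(** * Neighbourhoods in the link of a vertex *)

Section Offsets.
Context {n m : nat}.
Implicit Types (x y z : grid n m) (i j k l : 'I_n) (r : seq 'I_n).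

(* In the link of [x], [dn x i], [dd x i j] and [du x i j] stand for x - e_i,
   x - e_i - e_j and x - e_i + e_j. *)
Definition dd x i j := dn (dn x i) j.
Definition du x j k := up (dn x j) k.

Lemma ddE x i j l : (dd x i j l : nat) = (x l - (l == i) - (l == j))%N.
Proof. by rewrite /dd !dnE. Qed.

Lemma duE x j k l : (j == k) = false -> (x k < m)%N ->
  (du x j k l : nat) = (x l - (l == j) + (l == k))%N.
Proof. by move=> jk xk; rewrite /du upE ?dnE// eq_sym jk subn0. Qed.

Lemma agree_dd r x i j : i \in r -> j \in r -> agree r (dd x i j) x.
Proof. by move=> ir jr; do 2!apply: agree_dn => //. Qed.

Lemma agree_du r x i j : i \in r -> j \in r -> agree r (du x i j) x.
Proof. by move=> ir jr; apply: agree_up => //; apply: agree_dn. Qed.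

Lemma agree_dn1 r x i : i \in r -> agree r (dn x i) x.
Proof. by move=> ir; apply: agree_dn. Qed.

Lemma rest_refl r x : rest r x x = 0%N.
Proof. by rewrite /rest big1// => l _; rewrite subrr. Qed.

(* A name for the distance on [nat] that [lia] treats as an atom, which keeps
   the case analyses below from exploding. *)
Definition dst (a b : nat) : nat := `|a - b|%N.

Lemma nat_true : (true : nat) = 1%N. Proof. by []. Qed.
Lemma nat_false : (false : nat) = 0%N. Proof. by []. Qed.

Lemma dst_pred y x i : (0 < x i)%N ->
  dst (y i) (x i - 1) = (dst (y i) (x i)).+1 \/
  dst (y i) (x i) = (dst (y i) (x i - 1)).+1.
Proof. by rewrite /dst; lia. Qed.

Lemma dst_succ y x i :
  (y i <= x i /\ dst (y i) (x i + 1) = (dst (y i) (x i)).+1)%N \/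
  (x i < y i /\ dst (y i) (x i) = (dst (y i) (x i + 1)).+1)%N.
Proof. by rewrite /dst; lia. Qed.

Lemma dst0 (a b : nat) : dst a b = 0%N -> a = b.
Proof. by rewrite /dst; lia. Qed.

Definition coord_dst y z l : nat := dst (y l) (z l).

Lemma manhattan_dst r y z x : uniq r -> agree r z x ->
  manhattan y z = (\sum_(l <- r) coord_dst y z l + rest r y x)%N.
Proof. exact: manhattan_split. Qed.

Ltac dst_lia := repeat match goal with
  | |- context [dst ?a ?b] => generalize (dst a b); intro
  | |- context [rest ?r ?y ?x] => generalize (rest r y x); intro
  end; clear; lia.

Lemma uniq2E i j : uniq [:: i; j] -> (i == j) = false /\ (j == i) = false.
Proof. by rewrite /= inE andbT => /negbTE ij; rewrite (eq_sym j) ij. Qed.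

Lemma uniq3E i j k : uniq [:: i; j; k] ->
  ((i == j) = false /\ (j == i) = false) /\
  ((i == k) = false /\ (k == i) = false) /\ ((j == k) = false /\ (k == j) = false).
Proof.
rewrite /= !inE !negb_or andbT => /andP[/andP[/negbTE ij /negbTE ik] /negbTE jk].
by rewrite (eq_sym j i) (eq_sym k i) (eq_sym k j) ij ik jk.
Qed.

Lemma neq_at l y z : (y l : nat) <> z l -> y != z.
Proof. by move=> h; apply/eqP => yz; apply: h; rewrite yz. Qed.

Lemma ddC x i j : dd x i j = dd x j i.
Proof. by apply/ffunP => l; apply: val_inj; rewrite /= !ddE; lia. Qed.

Lemma dist_dn x i : (0 < x i)%N -> manhattan x (dn x i) = 1%N.
Proof.
move=> xi; rewrite (@manhattan_split _ _ [:: i] x (dn x i) x)//; last first.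
  by apply: agree_dn1; rewrite inE.
by rewrite big_cons big_nil rest_refl dnE eqxx; lia.
Qed.

Lemma dist_dd x i j : uniq [:: i; j] -> (0 < x i)%N -> (0 < x j)%N ->
  manhattan x (dd x i j) = 2%N.
Proof.
move=> u xi xj; have [ij ji] := uniq2E u.
rewrite (@manhattan_split _ _ [:: i; j] x (dd x i j) x)//; last first.
  by apply: agree_dd; rewrite !inE eqxx ?orbT.
by rewrite !big_cons big_nil rest_refl !ddE !eqxx ij ji; lia.
Qed.

Lemma dist_ddd x i : (1 < x i)%N -> manhattan x (dd x i i) = 2%N.
Proof.
move=> xi; rewrite (@manhattan_split _ _ [:: i] x (dd x i i) x)//; last first.
  by apply: agree_dd; rewrite !inE eqxx.
by rewrite !big_cons big_nil rest_refl !ddE !eqxx; lia.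
Qed.

Lemma dist_du x i j : uniq [:: i; j] -> (0 < x i)%N -> (x j < m)%N ->
  manhattan x (du x i j) = 2%N.
Proof.
move=> u xi xj; have [ij ji] := uniq2E u.
rewrite (@manhattan_split _ _ [:: i; j] x (du x i j) x)//; last first.
  by apply: agree_du; rewrite !inE eqxx ?orbT.
by rewrite !big_cons big_nil rest_refl !duE// !eqxx ij ji; lia.
Qed.

Lemma near_du x y i k : uniq [:: i; k] -> (0 < x i)%N -> (x k < m)%N ->
  (x k < y k)%N -> (manhattan y x <= 2)%N -> (manhattan y (du x i k) <= 2)%N.
Proof.
move=> u xi xk xy yx; have [ik ki] := uniq2E u.
have Ex := @manhattan_dst [:: i; k] y x x u (agree_refl _ x).
have Ed := @manhattan_dst [:: i; k] y (du x i k) x u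
  (agree_du _ (mem_head _ _) (mem_last _ _)).
move: Ex Ed; rewrite !big_cons !big_nil /coord_dst !duE// !eqxx ik ki !(nat_true, nat_false, addn0, subn0) => Ex Ed.
rewrite Ex in yx; rewrite Ed.
case: (dst_succ y x k) => -[xyk Ek]; first by move: xy; rewrite ltnNge xyk.
by move: yx (dst_pred y xi) Ek; dst_lia.
Qed.

Lemma near_up x y k : (x k < m)%N -> (x k < y k)%N -> (manhattan y x <= 2)%N ->
  (manhattan y (up x k) <= 1)%N.
Proof.
move=> xk xy yx.
have Ex := @manhattan_dst [:: k] y x x isT (agree_refl _ x).
have Ed := @manhattan_dst [:: k] y (up x k) x isT
  (agree_up (agree_refl _ x) (mem_head _ _)).
move: Ex Ed; rewrite !big_cons !big_nil /coord_dst !upE// !eqxx !(nat_true, nat_false, addn0, subn0) => Ex Ed.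
rewrite Ex in yx; rewrite Ed.
case: (dst_succ y x k) => -[xyk Ek]; first by move: xy; rewrite ltnNge xyk.
by move: yx Ek; dst_lia.
Qed.

Lemma dist_up x k : (x k < m)%N -> manhattan x (up x k) = 1%N.
Proof.
move=> xk.
have Ed := @manhattan_dst [:: k] x (up x k) x isT
  (agree_up (agree_refl _ x) (mem_head _ _)).
by move: Ed; rewrite !big_cons !big_nil /coord_dst !upE// !eqxx rest_refl /dst => ->; lia.
Qed.

(** If [y k <= x k], the raised coordinate costs 1 at both points, which [y] must regain at [j] and
    at [l] unless it is [x]. The last alternative completes a tetrahedron. *)
Lemma between_du x y j l k : uniq [:: j; l; k] ->
  (0 < x j)%N -> (0 < x l)%N -> (x k < m)%N ->
  (manhattan y x <= 2)%N -> (manhattan y (du x j k) <= 2)%N ->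
  (manhattan y (du x l k) <= 2)%N ->
  [\/ (x k < y k)%N, y = x | y = dd x j l].
Proof.
move=> u xj xl xk yx y1 y2; have [[jl lj] [[jk kj] [lk kl]]] := uniq3E u.
set r := [:: j; l; k] in u *.
have [jr lr kr] : [/\ j \in r, l \in r & k \in r] by rewrite !inE !eqxx !orbT.
have Ex := @manhattan_dst r y x x u (agree_refl _ x).
have E1 := @manhattan_dst r y (du x j k) x u (agree_du _ jr kr).
have E2 := @manhattan_dst r y (du x l k) x u (agree_du _ lr kr).
move: Ex E1 E2; rewrite !big_cons !big_nil /coord_dst !duE// !eqxx jl lj jk kj lk kl !(nat_true, nat_false, addn0, subn0) => Ex E1 E2.
rewrite Ex in yx; rewrite E1 in y1; rewrite E2 in y2.
case: (dst_succ y x k) => -[xyk Ek]; last by constructor 1.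
have [[r0 [j0 [l0 k0]]]|[r0 [j0 [l0 k0]]]] : (rest r y x = 0 /\ dst (y j) (x j) = 0 /\
    dst (y l) (x l) = 0 /\ dst (y k) (x k) = 0)%N \/ (rest r y x = 0 /\
    dst (y j) (x j - 1) = 0 /\ dst (y l) (x l - 1) = 0 /\ dst (y k) (x k) = 0)%N.
  by move: yx y1 y2 Ek (dst_pred y xj) (dst_pred y xl); dst_lia.
- constructor 2; apply: (eq_on r0 (agree_refl _ x)) => t.
  by rewrite !inE => /or3P[]/eqP->; exact: dst0.
- constructor 3; apply: (eq_on r0 (agree_dd _ jr lr)) => t.
  by rewrite !inE => /or3P[]/eqP->; apply: dst0;
    rewrite ddE ?eqxx ?jl ?lj ?jk ?kj ?lk ?kl !(nat_true, nat_false, subn0).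
Qed.

(** The exceptional point is the fourth vertex of the tetrahedron below [x] on the given three. *)
Lemma between_dd x y i j l : uniq [:: i; j; l] ->
  (0 < x i)%N -> (0 < x j)%N -> (0 < x l)%N ->
  (manhattan y x <= 2)%N -> (manhattan y (dd x i j) <= 2)%N ->
  (manhattan y (dd x i l) <= 2)%N ->
  (manhattan y (dn x i) <= 2)%N \/ y = dd x j l.
Proof.
move=> u xi xj xl yx y1 y2; have [[ij ji] [[il li] [jl lj]]] := uniq3E u.
set r := [:: i; j; l] in u *.
have [ir jr lr] : [/\ i \in r, j \in r & l \in r] by rewrite !inE !eqxx !orbT.
have Ex := @manhattan_dst r y x x u (agree_refl _ x).
have E1 := @manhattan_dst r y (dd x i j) x u (agree_dd _ ir jr).
have E2 := @manhattan_dst r y (dd x i l) x u (agree_dd _ ir lr).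
have E3 := @manhattan_dst r y (dn x i) x u (agree_dn1 _ ir).
move: Ex E1 E2 E3; rewrite !big_cons !big_nil /coord_dst !ddE// !dnE !eqxx ij ji il li jl lj.
rewrite !(nat_true, nat_false, addn0, subn0) => Ex E1 E2 E3.
rewrite E3; rewrite Ex in yx; rewrite E1 in y1; rewrite E2 in y2.
have [h|h] := leqP _ 2%N; [by left|right].
have [r0 [i1 [j0 l0]]] : (rest r y x = 0 /\ dst (y i) (x i) = 0 /\
    dst (y j) (x j - 1) = 0 /\ dst (y l) (x l - 1) = 0)%N.
  by move: yx y1 y2 h (dst_pred y xi) (dst_pred y xj) (dst_pred y xl); dst_lia.
apply: (eq_on r0 (agree_dd _ jr lr)) => t.
by rewrite !inE => /or3P[]/eqP->; apply: dst0;
  rewrite ddE ?eqxx ?ij ?ji ?il ?li ?jl ?lj !(nat_true, nat_false, subn0).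
Qed.

Lemma near_dn_of_du x y j k : uniq [:: j; k] -> (0 < x j)%N -> (x k < m)%N ->
  (manhattan y x <= 2)%N -> (manhattan y (du x j k) <= 2)%N ->
  (manhattan y (dn x j) <= 2)%N \/ ((x k < y k)%N /\ (x j <= y j)%N).
Proof.
move=> u xj xk yx y1; have [jk kj] := uniq2E u.
set r := [:: j; k] in u *.
have [jr kr] : j \in r /\ k \in r by rewrite !inE !eqxx !orbT.
have Ex := @manhattan_dst r y x x u (agree_refl _ x).
have E1 := @manhattan_dst r y (du x j k) x u (agree_du _ jr kr).
have E3 := @manhattan_dst r y (dn x j) x u (agree_dn1 _ jr).
move: Ex E1 E3; rewrite !big_cons !big_nil /coord_dst !duE// !dnE !eqxx jk kj !(nat_true, nat_false, addn0, subn0) => Ex E1 E3.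
rewrite E3; rewrite Ex in yx; rewrite E1 in y1.
case: (leqP (x j) (y j)) => xyj; last first.
  have Ej : dst (y j) (x j) = (dst (y j) (x j - 1)).+1 by move: xyj; rewrite /dst; clear; lia.
  by left; move: yx Ej; dst_lia.
case: (dst_succ y x k) => -[xyk Ek]; [left|by right].
by move: yx y1 Ek (dst_pred y xj); dst_lia.
Qed.

Lemma near_dn_of_ddd x y i : (1 < x i)%N -> (manhattan y x <= 2)%N ->
  (manhattan y (dd x i i) <= 2)%N -> (manhattan y (dn x i) <= 2)%N.
Proof.
move=> xi yx y1; set r := [:: i].
have ir : i \in r by rewrite inE.
have Ex := @manhattan_dst r y x x isT (agree_refl _ x).
have E1 := @manhattan_dst r y (dd x i i) x isT (agree_dd _ ir ir).
have E3 := @manhattan_dst r y (dn x i) x isT (agree_dn1 _ ir).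
move: Ex E1 E3; rewrite !big_cons !big_nil /coord_dst !ddE !dnE !eqxx /dst => Ex E1 E3.
by lia.
Qed.

Lemma exists_below r x y : (forall t, (y t <= x t)%N) -> (0 < rest r y x)%N ->
  exists2 l, l \notin r & (y l < x l)%N.
Proof.
move=> le r1; apply: contrapT => hN; move: r1; rewrite /rest big1// => l lr.
have : ~ (y l < x l)%N by move=> yl; apply: hN; exists l.
by move: (le l); clear; lia.
Qed.

Lemma near_dn_of_dd x y i j : uniq [:: i; j] -> (0 < x i)%N -> (0 < x j)%N ->
  (forall t, (y t <= x t)%N) -> (forall t, (x t <= (y t).+1)%N) ->
  (manhattan y x <= 2)%N -> (manhattan y (dd x i j) <= 2)%N ->
  (manhattan y (dn x i) <= 2)%N \/
  exists l, [/\ uniq [:: i; j; l], (0 < x l)%N & y = dd x j l].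
Proof.
move=> u xi xj le ge yx y1; have yx0 := yx; have [ij ji] := uniq2E u.
set r := [:: i; j] in u *.
have [ir jr] : i \in r /\ j \in r by rewrite !inE !eqxx !orbT.
have Ex := @manhattan_dst r y x x u (agree_refl _ x).
have E1 := @manhattan_dst r y (dd x i j) x u (agree_dd _ ir jr).
have E3 := @manhattan_dst r y (dn x i) x u (agree_dn1 _ ir).
move: Ex E1 E3; rewrite !big_cons !big_nil /coord_dst !ddE// !dnE !eqxx ij ji !(nat_true, nat_false, addn0, subn0) => Ex E1 E3.
rewrite E3; rewrite Ex in yx; rewrite E1 in y1.
have gj : (dst (y j) (x j) <= 1)%N.
  by move: (le j) (ge j); rewrite /dst; clear; lia.
have [h|h] := leqP _ 2%N; [by left|right].
have [r1 [i1 j1]] : (rest r y x = 1 /\ dst (y i) (x i) = 0 /\ dst (y j) (x j - 1) = 0)%N.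
  have gi : dst (y i) (x i) = 0%N \/ dst (y i) (x i) = (dst (y i) (x i - 1)).+1.
    by move: (le i) xi; rewrite /dst; clear; lia.
  by move: yx y1 h gi gj (dst_pred y xi) (dst_pred y xj); dst_lia.
have [l lr yl] : exists2 l, l \notin r & (y l < x l)%N.
  by apply: exists_below => //; rewrite r1.
have ul : uniq [:: i; j; l].
  move: lr; rewrite /= !inE !negb_or => /andP[li lj].
  by rewrite ij eq_sym li eq_sym lj.
exists l; split=> //; first by rewrite (leq_trans _ yl).
have [[_ _] [[il li] [jl lj]]] := uniq3E ul.
set q := [:: i; j; l] in ul.
have [iq jq lq] : [/\ i \in q, j \in q & l \in q] by rewrite !inE !eqxx !orbT.
have Eq := @manhattan_dst q y x x ul (agree_refl _ x).
move: Eq; rewrite !big_cons !big_nil /coord_dst => Eq.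
have Dl : (0 < dst (y l) (x l))%N by move: yl; rewrite /dst; clear; lia.
have El : dst (y l) (x l) = (dst (y l) (x l - 1)).+1.
  by move: yl; rewrite /dst; clear; lia.
have [q0 l0] : (rest q y x = 0 /\ dst (y l) (x l - 1) = 0)%N.
  have Ej : dst (y j) (x j) = (dst (y j) (x j - 1)).+1.
    by move: (dst0 j1) xj; rewrite /dst; clear; lia.
  by move: yx0 Eq El Ej j1 Dl => /[swap]->; dst_lia.
apply: (eq_on q0 (agree_dd _ jq lq)) => t.
rewrite !inE => /or3P[]/eqP->; apply: dst0;
  by rewrite ddE ?eqxx ?ij ?ji ?il ?li ?jl ?lj !(nat_true, nat_false, subn0).
Qed.

Lemma manhattan_dn_le x y i : (0 < x i)%N ->
  (manhattan y (dn x i) <= (manhattan y x).+1)%N.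
Proof.
move=> xi; have ir : i \in [:: i] by rewrite inE.
have Ex := @manhattan_dst [:: i] y x x isT (agree_refl _ x).
have E3 := @manhattan_dst [:: i] y (dn x i) x isT (agree_dn1 _ ir).
move: Ex E3; rewrite !big_cons !big_nil /coord_dst !dnE !eqxx !nat_true => -> ->.
by move: (dst_pred y xi); dst_lia.
Qed.

Lemma two_below x y : (forall t, (y t <= x t)%N) -> (forall t, (x t <= (y t).+1)%N) ->
  manhattan y x = 2%N ->
  exists i j, [/\ uniq [:: i; j], (0 < x i)%N, (0 < x j)%N & y = dd x i j].
Proof.
move=> le ge yx.
have D1 l : (y l < x l)%N -> dst (y l) (x l) = 1%N /\ dst (y l) (x l - 1) = 0%N.
  by move: (ge l); rewrite /dst; clear; lia.
have E0 := @manhattan_dst [::] y x x isT (agree_refl _ x); rewrite big_nil in E0.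
have [i _ yi] : exists2 l, l \notin [::] & (y l < x l)%N.
  by apply: exists_below => //; rewrite -[rest _ _ _]add0n -E0 yx.
have [di di'] := D1 i yi.
have E1 := @manhattan_dst [:: i] y x x isT (agree_refl _ x).
rewrite big_cons big_nil /coord_dst di yx in E1.
have [j ji yj] : exists2 l, l \notin [:: i] & (y l < x l)%N.
  by apply: exists_below => //; move: E1; dst_lia.
have [dj dj'] := D1 j yj.
have u : uniq [:: i; j] by move: ji; rewrite /= !inE eq_sym => ->.
have [ij ji'] := uniq2E u.
have E2 := @manhattan_dst [:: i; j] y x x u (agree_refl _ x).
rewrite !big_cons big_nil /coord_dst di dj yx in E2.
have r0 : rest [:: i; j] y x = 0%N by move: E2; dst_lia.
exists i, j; split=> //; [exact: leq_ltn_trans yi|exact: leq_ltn_trans yj|].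
have [ir jr] : i \in [:: i; j] /\ j \in [:: i; j] by rewrite !inE !eqxx !orbT.
apply: (eq_on r0 (agree_dd _ ir jr)) => t.
by rewrite !inE => /orP[]/eqP->; apply: dst0;
  rewrite ddE ?eqxx ?ij ?ji' !(nat_true, nat_false, subn0).
Qed.

Lemma eq_ddd x y i : (manhattan y x <= 2)%N -> ((y i).+1 < x i)%N -> y = dd x i i.
Proof.
move=> yx yi; have ir : i \in [:: i] by rewrite inE.
have E1 := @manhattan_dst [:: i] y x x isT (agree_refl _ x).
rewrite big_cons big_nil /coord_dst in E1.
have D2 : (2 <= dst (y i) (x i))%N by move: yi; rewrite /dst; clear; lia.
have r0 : rest [:: i] y x = 0%N by move: yx D2; rewrite E1; dst_lia.
apply: (eq_on r0 (agree_dd _ ir ir)) => t; rewrite inE => /eqP ->.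
have D3 : (dst (y i) (x i) <= 2)%N by move: yx; rewrite E1; dst_lia.
by rewrite ddE eqxx nat_true; move: D3 yi; rewrite /dst; clear; lia.
Qed.

(** By [dn_weight] an excess anywhere makes the weight strictly smaller, so equal weights allow none
    in either direction. Hence a simplex has a unique heaviest vertex. *)
Lemma weight_inj x y : (manhattan y x <= 2)%N -> weight y = weight x -> y = x.
Proof.
have le (a b : grid n m) : (manhattan a b <= 2)%N -> weight a = weight b ->
    forall t, (a t <= b t)%N.
  move=> ab wab t; rewrite leqNgt; apply/negP => bat.
  have [|j [jt bj bt aE]] := dn_weight ab _ bat; first by rewrite wab.
  by have := weight_dn_up bj bt jt; rewrite -aE wab ltnn.
move=> yx w; apply/ffunP => t; apply: val_inj; apply/eqP.
by rewrite /= eqn_leq (le y x yx w t) (le x y _ (esym w) t)// manhattanC.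
Qed.

Lemma weight_dd x i j : uniq [:: i; j] -> (0 < x i)%N -> (0 < x j)%N ->
  (weight (dd x i j) < weight x)%N.
Proof.
move=> u xi xj; have [ij ji] := uniq2E u.
by apply: ltn_trans (weight_dn xi); apply: weight_dn; rewrite dnE ji subn0.
Qed.

Lemma dist_dd_du x i k l j : uniq [:: i; j; k] -> l = i \/ l = j ->
  (0 < x i)%N -> (0 < x j)%N -> (x k < m)%N ->
  manhattan (du x l k) (dd x i j) = 2%N.
Proof.
move=> u lij xi xj xk; have [[ij ji] [[ik ki] [jk kj]]] := uniq3E u.
set r := [:: i; j; k] in u *.
have [ir jr kr] : [/\ i \in r, j \in r & k \in r] by rewrite !inE !eqxx !orbT.
have lr : l \in r by case: lij => ->.
have E1 := @manhattan_split _ _ r (du x l k) (dd x i j) x u (agree_dd _ ir jr).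
have r0 : rest r (du x l k) x = 0%N.
  by rewrite /rest big1// => t tr; rewrite (agree_du x lr kr)// subrr.
move: E1; rewrite r0 !big_cons !big_nil !ddE.
have lk : (l == k) = false by case: lij => ->.
rewrite !duE// !eqxx ij ji ik ki jk kj.
by case: lij => ->; rewrite ?eqxx ?ij ?ji ?ik ?ki ?jk ?kj => ->;
  rewrite !(nat_true, nat_false, subn0, addn0); move: xi xj; clear; lia.
Qed.

Lemma critical_ddd x i j k : uniq [:: i; j; k] ->
  (0 < x i)%N -> (0 < x j)%N -> (0 < x k)%N ->
  critical [set x; dd x i j; dd x i k; dd x j k]%SET.
Proof.
move=> u xi xj xk; have [[ij ji] [[ik ki] [jk kj]]] := uniq3E u.
set r := [:: i; j; k] in u *.
have [ir jr kr] : [/\ i \in r, j \in r & k \in r] by rewrite !inE !eqxx !orbT.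
have [s4 sd smax] := @tetrahedron_geometry _ _ x (dd x i j) (dd x i k) (dd x j k) x
  i j k (x i).-1 (x j).-1 (x k) (x k).-1 u (agree_refl _ x) (agree_dd x ir jr)
  (agree_dd x ir kr) (agree_dd x jr kr) (or_intror (esym (prednK xk)))
  ltac:(split; move: xi xj; clear; lia) ltac:(split; rewrite ddE ?eqxx ?ij ?ji ?ik ?ki ?jk ?kj; move: xi xj xk; clear; lia)
  ltac:(split; rewrite ddE ?eqxx ?ij ?ji ?ik ?ki ?jk ?kj; move: xi xj xk; clear; lia)
  ltac:(split; rewrite ddE ?eqxx ?ij ?ji ?ik ?ki ?jk ?kj; move: xi xj xk; clear; lia).
have le y : y \in [set x; dd x i j; dd x i k; dd x j k]%SET -> forall t, (y t <= x t)%N.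
  by rewrite !inE -!orbA => /or4P[]/eqP-> t; rewrite ?ddE; clear; lia.
split=> //; exists x; first by rewrite !inE eqxx.
split; last by left.
by move=> y /le yx; apply: leq_sum => l _; rewrite leq_mul2l yx orbT.
Qed.

(** All coordinates that move come after [i0], so the second alternative of [critical] holds with
    [i0]. *)
Lemma critical_ddu x i0 i j k : uniq [:: i; j; k] ->
  (0 < x i0)%N -> (0 < x i)%N -> (0 < x j)%N -> (x k < m)%N ->
  (i0 < i)%N -> (i0 < j)%N -> (i < k)%N -> (j < k)%N ->
  critical [set x; dd x i j; du x i k; du x j k]%SET.
Proof.
move=> u xi0 xi xj xk i0i i0j lik ljk; have [[ij ji] [[ik ki] [jk kj]]] := uniq3E u.
set r := [:: i; j; k] in u *.
have [ir jr kr] : [/\ i \in r, j \in r & k \in r] by rewrite !inE !eqxx !orbT.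
have [s4 sd smax] := @tetrahedron_geometry _ _ x (dd x i j) (du x i k) (du x j k) x
  i j k (x i).-1 (x j).-1 (x k) (x k).+1 u (agree_refl _ x) (agree_dd x ir jr)
  (agree_du x ir kr) (agree_du x jr kr) (or_introl erefl)
  ltac:(split; move: xi xj; clear; lia) ltac:(split; rewrite ddE ?eqxx ?ij ?ji ?ik ?ki ?jk ?kj; move: xi xj; clear; lia)
  ltac:(split; rewrite duE// ?eqxx ?ij ?ji ?ik ?ki ?jk ?kj; move: xi xj; clear; lia)
  ltac:(split; rewrite duE// ?eqxx ?ij ?ji ?ik ?ki ?jk ?kj; move: xi xj; clear; lia).
split=> //; exists x; first by rewrite !inE eqxx.
split; last first.
  right; exists i0 => // y ys l li0.
  have lr : l \notin r by rewrite !inE -!val_eqE/= !ltn_eqF//; move: i0i i0j lik ljk li0; clear; lia.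
  move: ys; rewrite !inE -!orbA => /or4P[]/eqP-> //.
  - exact: (agree_dd x ir jr).
  - exact: (agree_du x ir kr).
  - exact: (agree_du x jr kr).
move=> y; rewrite !inE -!orbA => /or4P[]/eqP-> //.
- apply: leq_sum => l _; rewrite leq_mul2l ddE; clear; lia.
- exact/ltnW/weight_dn_up.
- exact/ltnW/weight_dn_up.
Qed.

End Offsets.

(** * Removing the heaviest vertex *)

Section Elimination.
Context {n m : nat}.
Context (U : {set grid n m}) (x : grid n m) (i0 : 'I_n).
Hypothesis xi0 : (0 < x i0)%N.
Hypothesis i0_min : forall i, (0 < x i)%N -> (i0 <= i)%N.
Hypothesis U_down : forall y z, y \in U -> (weight z < weight y)%N -> z \in U.
Hypothesis xU : x \in U.
Hypothesis x_max : forall y, y \in U -> (weight y <= weight x)%N.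
Implicit Types (y z v : grid n m) (i j k l : 'I_n) (s tau : {set grid n m}).

Definition stage0 s : bool := VR2_deleted s && (s \subset U).

(* The r-th relation holds of [tau] and [v] when the r-th stage removes the open
   star of [tau], whose link is by then a cone with apex [v]. *)
Definition faces1 tau v : Prop := exists j l k,
  [/\ uniq [:: j; l; k], uniq [:: i0; j], uniq [:: i0; l],
      [/\ (j < k)%N, (l < k)%N, (0 < x j)%N, (0 < x l)%N & (x k < m)%N] &
      tau = [set x; du x j k; du x l k]%SET /\ v = du x i0 k].

(** The apex is the fourth vertex of the kept tetrahedron on [tau]. *)
Definition faces2 tau v : Prop := exists j k,
  [/\ uniq [:: i0; j; k], (i0 < k)%N, [/\ (j < k)%N, (0 < x j)%N & (x k < m)%N],
      tau = [set x; du x i0 k; du x j k]%SET & v = dd x i0 j].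

Definition faces3 tau v : Prop :=
  (exists j k, [/\ (j < k)%N, (0 < x j)%N, (x k < m)%N,
      tau = [set x; du x j k]%SET & v = dn x j]) \/
  (exists i, [/\ (1 < x i)%N, tau = [set x; dd x i i]%SET & v = dn x i]).

Definition faces4 tau v : Prop := exists i j l,
  [/\ uniq [:: i; j; l], (0 < x i)%N, (0 < x j)%N /\ (0 < x l)%N,
      tau = [set x; dd x i j; dd x i l]%SET & v = dn x i].

Definition faces5 tau v : Prop := exists i j,
  [/\ uniq [:: i; j], (0 < x i)%N, (0 < x j)%N,
      tau = [set x; dd x i j]%SET & v = dn x i].

Definition faces6 tau v : Prop := tau = [set x]%SET /\ v = dn x i0.

Definition stage1 := avoid faces1 stage0.
Definition stage2 := avoid faces2 stage1.
Definition stage3 := avoid faces3 stage2.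
Definition stage4 := avoid faces4 stage3.
Definition stage5 := avoid faces5 stage4.
Definition stage6 := avoid faces6 stage5.

Lemma i0_lt j : uniq [:: i0; j] -> (0 < x j)%N -> (i0 < j)%N.
Proof.
move=> /uniq2E[i0j _] /i0_min; rewrite leq_eqVlt => /orP[|//].
by rewrite val_eqE i0j.
Qed.

Lemma ltn_uniq j k : (j < k)%N -> uniq [:: j; k].
Proof. by move=> jk; rewrite /= inE andbT -val_eqE/= ltn_eqF. Qed.

Lemma ltn_eqF' j k : (j < k)%N -> (j == k) = false.
Proof. by move=> /ltn_uniq/uniq2E[]. Qed.

Lemma stage0P s : stage0 s -> [/\ VR2 s, ~ critical s & s \subset U].
Proof.
by move=> /andP[/andP[Ks sT] sU]; split=> // cs; move: sT => /negP; apply; apply/tetrahedraP.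
Qed.

Lemma stage0_near s y z : stage0 s -> y \in s -> z \in s -> (manhattan y z <= 2)%N.
Proof. by move=> /stage0P[/VR2P[_ sd] _ _]; exact: sd. Qed.

Lemma stage0_weight s y : stage0 s -> y \in s -> (weight y <= weight x)%N.
Proof. by move=> /stage0P[_ _ /fintype.subsetP sU] /sU; exact: x_max. Qed.

Lemma stage0_critical s t : stage0 s -> critical t -> t \subset s -> False.
Proof. by move=> /stage0P[Ks cs _] ct ts; apply: cs; rewrite (critical_facet ct Ks ts). Qed.

Lemma stage0_add s v : stage0 s -> (weight v < weight x)%N ->
  (forall y, y \in s -> (manhattan y v <= 2)%N) -> ~ critical (v |: s) ->
  stage0 (v |: s).
Proof.
move=> ls wv sv cv; have [/VR2P[s0 sd] _ sU] := stage0P ls.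
apply/andP; split; last first.
  by rewrite finset.subUset sU andbT finset.sub1set; apply: U_down xU wv.
apply/andP; split; last by apply/negP => /tetrahedraP.
apply/VR2P; split; first by apply/set0Pn; exists v; rewrite !inE eqxx.
move=> y z; rewrite !inE => /predU1P[->|ys] /predU1P[->|zs].
- by rewrite manhattanxx.
- by rewrite manhattanC sv.
- exact: sv.
- exact: sd.
Qed.

Lemma stage0_add_dn s i : stage0 s -> x \in s -> (0 < x i)%N ->
  (forall y, y \in s -> (manhattan y (dn x i) <= 2)%N) -> stage0 (dn x i |: s).
Proof.
move=> ls xs xi sv; apply: stage0_add => //; first exact: weight_dn.
move=> cv; have := critical_dist cv (y := x) (z := dn x i).
by rewrite !inE eqxx xs orbT => /(_ isT isT); rewrite dist_dn.
Qed.

Lemma down_closed_stage0 : down_closed stage0.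
Proof.
move=> s s' /andP[Ks sU] s'0 ss'; apply/andP; split.
  exact: (down_closed_deleted Ks).
exact: fintype.subset_trans ss' sU.
Qed.

Lemma faces1P s : stage0 s -> forall j l k, uniq [:: j; l; k] ->
  (0 < x j)%N -> (0 < x l)%N -> (x k < m)%N -> x \in s ->
  du x j k \in s -> du x l k \in s -> forall y, y \in s ->
  [\/ (x k < y k)%N, y = x | y = dd x j l].
Proof.
move=> ls j l k u xj xl xk xs js ks y ys.
by apply: (between_du u) => //; exact: (stage0_near ls).
Qed.

(** Apexes drop in the coordinate [i0]; no vertex of these faces does. *)
Lemma faces1_apart tau v tau' v' : faces1 tau v -> faces1 tau' v' -> v \notin tau'.
Proof.
case=> j1 [l1 [k1 [_ uj1 _ [jk1 _ xj1 _ xk1] [_ ->]]]].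
case=> j [l [k [u uj ul [jk lk xj xl xk] [-> _]]]].
have i0k1 := ltn_trans (i0_lt uj1 xj1) jk1.
have le z : z \in [set x; du x j k; du x l k]%SET -> (x i0 <= z i0)%N.
  rewrite !inE -orbA => /or3P[]/eqP-> //; rewrite duE ?(ltn_eqF' jk) ?(ltn_eqF' lk)//.
  + by rewrite (ltn_eqF' (i0_lt uj xj)); clear; lia.
  + by rewrite (ltn_eqF' (i0_lt ul xl)); clear; lia.
apply/negP => /le; rewrite duE ?(ltn_eqF' i0k1)// eqxx.
by move: xi0; clear; lia.
Qed.

Lemma dd_neq_du i j l k : (l < k)%N -> (x k < m)%N -> dd x i j != du x l k.
Proof.
move=> lk xk; apply: (neq_at (l := k)).
by rewrite ddE duE ?(ltn_eqF' lk)// (eq_sym k l) (ltn_eqF' lk) eqxx; clear; lia.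
Qed.

Lemma dd_neq j : dd x i0 j != x.
Proof. by apply: (neq_at (l := i0)); rewrite ddE eqxx; move: xi0; clear; lia. Qed.

(** An apex exceeds [x] nowhere and differs from it, whereas the other vertices of these faces
    exceed [x] at some [k]. *)
Lemma faces2_apart tau v tau' v' : faces2 tau v -> faces2 tau' v' -> v \notin tau'.
Proof.
case=> j1 [k1 [_ _ _ _ ->]]; case=> j [k [_ i0k [jk _ xk] -> _]].
by rewrite !inE !negb_or dd_neq !dd_neq_du.
Qed.

Lemma faces1_removable tau v : faces1 tau v -> removable stage0 tau v.
Proof.
case=> j [l [k [u uj ul [jk lk xj xl xk] [-> ->]]]].
have i0j := i0_lt uj xj; have i0l := i0_lt ul xl.
have i0k := ltn_trans i0j jk; have ui0k := ltn_uniq i0k.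
split.
- by apply/set0Pn; exists x; rewrite !inE eqxx.
- have ft : faces1 [set x; du x j k; du x l k]%SET (du x i0 k) by exists j, l, k.
  exact: (faces1_apart ft ft).
move=> s ls /fintype.subsetP ts.
have xs : x \in s by apply: ts; rewrite !inE eqxx.
have js : du x j k \in s by apply: ts; rewrite !inE eqxx !orbT.
have ks : du x l k \in s by apply: ts; rewrite !inE eqxx !orbT.
(* The third alternative of [between_du] would place a deleted tetrahedron inside [s]. *)
have sP y : y \in s -> (x k < y k)%N \/ y = x.
  move=> ys; have [|->|yE] := faces1P ls u xj xl xk xs js ks ys; [by left|by right|].
  exfalso; apply: (stage0_critical ls (critical_ddu u xi0 xj xl xk i0j i0l jk lk)).
  apply/fintype.subsetP => z; rewrite !inE -!orbA => /or4P[]/eqP-> //.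
  by rewrite -yE.
have sd y : y \in s -> (manhattan y x <= 2)%N by move=> ys; exact: (stage0_near ls).
apply: stage0_add => //; first exact: weight_dn_up.
  move=> y ys; case: (sP y ys) => [xyk|->]; last by rewrite dist_du.
  by apply: near_du => //; exact: sd.
(* The point [x + e_k] is within 2 of every vertex, so maximality would put it in the critical
   simplex, at distance 1 from [x]. *)
move=> cv; have [_ _ vmax _] := cv.
have uv : up x k \in du x i0 k |: s.
  apply: vmax => z; rewrite !inE manhattanC => /predU1P[->|zs].
    apply: leq_trans (near_up xk _ _) _ => //.
      by rewrite duE ?(ltn_eqF' i0k)// (eq_sym k) (ltn_eqF' i0k) eqxx; clear; lia.
    by rewrite manhattanC dist_du.
  case: (sP z zs) => [xzk|->]; last by rewrite dist_up.
  by apply: leq_trans (near_up xk xzk _) _ => //; exact: sd.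
have := critical_dist (y := x) cv _ uv; rewrite !inE xs orbT => /(_ isT).
by rewrite dist_up.
Qed.

Lemma faces2_removable tau v : faces2 tau v -> removable stage1 tau v.
Proof.
case=> j [k [u i0k [jk xj xk] -> ->]].
have [[i0j' ji0] [[i0k' ki0] [jk' kj]]] := uniq3E u.
have uj : uniq [:: i0; j] by rewrite /= inE i0j'.
split.
- by apply/set0Pn; exists x; rewrite !inE eqxx.
- by rewrite !inE !negb_or dd_neq !dd_neq_du.
move=> s ls1 /fintype.subsetP ts; have [ls f1] := (avoidP _ _ _).1 ls1.
have xs : x \in s by apply: ts; rewrite !inE eqxx.
have i0s : du x i0 k \in s by apply: ts; rewrite !inE eqxx !orbT.
have js : du x j k \in s by apply: ts; rewrite !inE eqxx !orbT.
have sd y : y \in s -> (manhattan y x <= 2)%N by move=> ys; exact: (stage0_near ls).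
apply: avoid_add => //; last first.
  move=> tau' v' [j' [l' [k' [u' _ _ [jk1 lk1 xj1 xl1 xk1] [-> _]]]]].
  by rewrite !inE !negb_or dd_neq !dd_neq_du.
have wv : (weight (dd x i0 j) < weight x)%N by exact: weight_dd.
apply: stage0_add => //.
- move=> y ys.
  have [xyk|->|->] := faces1P ls u xi0 xj xk xs i0s js ys; last first.
  + by rewrite manhattanxx.
  + by rewrite dist_dd.
  (* A vertex above [x] at [k] is some [x - e_l + e_k]; the first batch leaves only [l = i0] or
     [l = j]. *)
  have [l [lk xl _ yE]] := dn_weight (sd y ys) (stage0_weight ls ys) xyk; rewrite -/(du x l k) in yE.
  have [li0|li0] := eqVneq l i0; first by rewrite yE (dist_dd_du u)//; left.
  have [lj|lj] := eqVneq l j; first by rewrite yE (dist_dd_du u)//; right.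
  have := f1 [set x; du x j k; du x l k]%SET (du x i0 k).
  suff fl : faces1 [set x; du x j k; du x l k]%SET (du x i0 k).
    move=> /(_ fl) /negP[]; apply/fintype.subsetP => z.
    by rewrite !inE -orbA => /or3P[]/eqP-> //; rewrite -yE.
  exists j, l, k; split=> //.
  + by rewrite /= !inE (eq_sym j l) (negbTE lj) jk' (ltn_eqF' lk).
  + by rewrite /= inE eq_sym li0.
(* This tetrahedron is a kept one: its heaviest vertex is [x], but [x - e_j + e_k] is not below [x],
   and [x - e_i0 + e_k] differs at [i0], the first coordinate where [x] is positive. *)
- move=> [_ _ _ [x' x's [x'max x'P]]].
  have x'E : x' = x.
    have wx : (weight x <= weight x')%N by apply: x'max; rewrite !inE xs orbT.
    move: x's; rewrite !inE => /predU1P[x'v|x's].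
      by move: wx; rewrite x'v leqNgt wv.
    apply: weight_inj; first exact: sd.
    by apply/eqP; rewrite eqn_leq wx (stage0_weight ls x's).
  have hI z : z \in s -> z \in dd x i0 j |: s by rewrite !inE => ->; rewrite orbT.
  case: x'P => [h|[i' xi' h]].
    have := h _ (hI _ js) k; rewrite x'E duE// kj eqxx; clear; lia.
  have := h _ (hI _ i0s) i0; rewrite x'E in xi' *; move=> /(_ (i0_min xi')).
  move=> h'; have : (du x i0 k i0 : nat) <> x i0; last by rewrite h'.
  by rewrite duE// eqxx i0k'; move: xi0; clear; lia.
Qed.

(** Pairs of distinct indices involving [i0] were removed by the second batch, all other pairs by
    the first. *)
Lemma faces2P s j l k : stage2 s -> x \in s -> (j < k)%N -> (l < k)%N ->
  (0 < x j)%N -> (0 < x l)%N -> (x k < m)%N -> du x j k \in s -> du x l k \in s ->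
  j = l.
Proof.
move=> /avoidP[/avoidP[ls f1] f2] xs jk lk xj xl xk js ks.
apply/eqP; apply: contraT => jl.
have f2' a : i0 != a -> (a < k)%N -> (0 < x a)%N -> du x i0 k \in s -> du x a k \in s -> False.
  move=> ia ak xa i0s as'; have ui : uniq [:: i0; a] by rewrite /= inE ia.
  have i0k : (i0 < k)%N by apply: ltn_trans ak; apply: i0_lt.
  suff fa : faces2 [set x; du x i0 k; du x a k]%SET (dd x i0 a).
    move: (f2 _ _ fa) => /negP; apply; apply/fintype.subsetP => z.
    by rewrite !inE -orbA => /or3P[]/eqP->.
  exists a, k; split=> //.
  by rewrite /= !inE (negbTE ia) (ltn_eqF' i0k) (ltn_eqF' ak).
have [ji|ji] := eqVneq i0 j.
  by exfalso; apply: (f2' l) => //; rewrite ?ji.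
have [li|li] := eqVneq i0 l.
  by exfalso; apply: (f2' j) => //; rewrite ?li.
suff fa : faces1 [set x; du x j k; du x l k]%SET (du x i0 k).
  exfalso; move: (f1 _ _ fa) => /negP; apply; apply/fintype.subsetP => z.
  by rewrite !inE -orbA => /or3P[]/eqP->.
exists j, l, k; split; rewrite /= ?inE ?ji ?li//.
by rewrite negb_or jl (ltn_eqF' jk) (ltn_eqF' lk).
Qed.

(** Parity argument for the later batches: every apex is some [x - e_i], at distance 1 from [x], and
    removed faces avoid that distance. *)
Lemma notin_even tau i : (0 < x i)%N ->
  (forall z, z \in tau -> manhattan x z != 1%N) -> dn x i \notin tau.
Proof. by move=> xi h; apply/negP => /h; rewrite dist_dn. Qed.

Lemma faces1_even tau v z : faces1 tau v -> z \in tau -> manhattan x z != 1%N.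
Proof.
case=> j [l [k [u _ _ [jk lk xj xl xk] [-> _]]]].
rewrite !inE -orbA => /or3P[]/eqP->; first by rewrite manhattanxx.
- by rewrite dist_du//; exact: ltn_uniq.
- by rewrite dist_du//; exact: ltn_uniq.
Qed.

Lemma faces2_even tau v z : faces2 tau v -> z \in tau -> manhattan x z != 1%N.
Proof.
case=> j [k [u i0k [jk xj xk] -> _]].
rewrite !inE -orbA => /or3P[]/eqP->; first by rewrite manhattanxx.
- by rewrite dist_du//; exact: ltn_uniq.
- by rewrite dist_du//; exact: ltn_uniq.
Qed.

Lemma faces3_even tau v z : faces3 tau v -> z \in tau -> manhattan x z != 1%N.
Proof.
case=> [[j [k [jk xj xk -> _]]]|[i [xi -> _]]]; rewrite !inE => /orP[]/eqP->;
  rewrite ?manhattanxx//; last by rewrite dist_ddd.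
by rewrite dist_du//; exact: ltn_uniq.
Qed.

Lemma faces4_even tau v z : faces4 tau v -> z \in tau -> manhattan x z != 1%N.
Proof.
case=> i [j [l [u xi [xj xl] -> _]]].
have [[ij _] [[il _] _]] := uniq3E u.
rewrite !inE -orbA => /or3P[]/eqP->; rewrite ?manhattanxx// dist_dd// /= inE.
- by rewrite ij.
- by rewrite il.
Qed.

Lemma faces5_even tau v z : faces5 tau v -> z \in tau -> manhattan x z != 1%N.
Proof.
case=> i [j [u xi xj -> _]].
by rewrite !inE => /orP[]/eqP->; rewrite ?manhattanxx// dist_dd.
Qed.

Lemma stage2_add_dn s i : stage2 s -> x \in s -> (0 < x i)%N ->
  (forall y, y \in s -> (manhattan y (dn x i) <= 2)%N) -> stage2 (dn x i |: s).
Proof.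
move=> s2 xs xi sv; have s1 := avoidW s2; have s0 := avoidW s1.
apply: avoid_add => //; first (apply: avoid_add => //; first exact: stage0_add_dn).
- by move=> tau v ft; apply: notin_even => // z; exact: faces1_even ft.
- by move=> tau v ft; apply: notin_even => // z; exact: faces2_even ft.
Qed.

Lemma stage3_add_dn s i : stage3 s -> x \in s -> (0 < x i)%N ->
  (forall y, y \in s -> (manhattan y (dn x i) <= 2)%N) -> stage3 (dn x i |: s).
Proof.
move=> s3 xs xi sv; apply: avoid_add => //.
  by apply: stage2_add_dn => //; exact: avoidW s3.
by move=> tau v ft; apply: notin_even => // z; exact: faces3_even ft.
Qed.

Lemma stage4_add_dn s i : stage4 s -> x \in s -> (0 < x i)%N ->
  (forall y, y \in s -> (manhattan y (dn x i) <= 2)%N) -> stage4 (dn x i |: s).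
Proof.
move=> s4 xs xi sv; apply: avoid_add => //.
  by apply: stage3_add_dn => //; exact: avoidW s4.
by move=> tau v ft; apply: notin_even => // z; exact: faces4_even ft.
Qed.

Lemma stage5_add_dn s i : stage5 s -> x \in s -> (0 < x i)%N ->
  (forall y, y \in s -> (manhattan y (dn x i) <= 2)%N) -> stage5 (dn x i |: s).
Proof.
move=> s5 xs xi sv; apply: avoid_add => //.
  by apply: stage4_add_dn => //; exact: avoidW s5.
by move=> tau v ft; apply: notin_even => // z; exact: faces5_even ft.
Qed.

Lemma stage0_local s y : stage0 s -> x \in s -> y \in s ->
  (manhattan y x <= 2)%N /\ (weight y <= weight x)%N.
Proof. by move=> s0 xs ys; rewrite (stage0_near s0)// (stage0_weight s0). Qed.

Lemma faces3_removable tau v : faces3 tau v -> removable stage2 tau v.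
Proof.
move=> ft; have ev z := faces3_even (z := z) ft.
case: ft ev => [[j [k [jk xj xk -> ->]]]|[i [xi -> ->]]] ev.
- split; [by apply/set0Pn; exists x; rewrite !inE eqxx|exact: notin_even|].
  move=> s s2 /fintype.subsetP ts; have s0 := avoidW (avoidW s2).
  have xs : x \in s by apply: ts; rewrite !inE eqxx.
  have js : du x j k \in s by apply: ts; rewrite !inE eqxx !orbT.
  apply: stage2_add_dn => // y ys; have [yx wy] := stage0_local s0 xs ys.
  have yj := stage0_near s0 ys js.
  (* The bad case is a second point raised at [k]; [faces2P] identifies it with [x - e_j + e_k],
     which does drop at [j]. *)
  have [//|[xyk xyj]] := near_dn_of_du (ltn_uniq jk) xj xk yx yj.
  have [l [lk xl _ yE]] := dn_weight yx wy xyk; exfalso; rewrite -/(du x l k) in yE.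
  have jl : j = l by apply: (faces2P s2 xs jk lk) => //; rewrite -yE.
  move: xyj; rewrite yE -jl duE ?eqxx ?(ltn_eqF' jk)//; move: xj; clear; lia.
- have xi1 : (0 < x i)%N by apply: ltn_trans xi.
  split; [by apply/set0Pn; exists x; rewrite !inE eqxx|exact: notin_even|].
  move=> s s2 /fintype.subsetP ts; have s0 := avoidW (avoidW s2).
  have xs : x \in s by apply: ts; rewrite !inE eqxx.
  have js : dd x i i \in s by apply: ts; rewrite !inE eqxx !orbT.
  apply: stage2_add_dn => // y ys; have [yx wy] := stage0_local s0 xs ys.
  by apply: near_dn_of_ddd => //; exact: (stage0_near s0).
Qed.

(** A coordinate above [x] makes [y] some [x - e_l + e_t], a drop of 2 makes it [x - 2e_t], and both
    are gone. What remains of the link lies in the unit cube below [x]. *)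
Lemma faces3P s y : stage3 s -> x \in s -> y \in s ->
  [/\ (manhattan y x <= 2)%N, forall t, (y t <= x t)%N & forall t, (x t <= (y t).+1)%N].
Proof.
move=> /avoidP[s2 f3] xs ys; have s0 := avoidW (avoidW s2).
have [yx wy] := stage0_local s0 xs ys; split=> // t; rewrite leqNgt; apply/negP => xyt.
- have [l [lt xl xt yE]] := dn_weight yx wy xyt; rewrite -/(du x l t) in yE.
  have /f3/negP[] : faces3 [set x; du x l t]%SET (dn x l) by left; exists l, t.
  by apply/fintype.subsetP => z; rewrite !inE => /orP[]/eqP-> //; rewrite -yE.
- have yE := eq_ddd yx xyt.
  have /f3/negP[] : faces3 [set x; dd x t t]%SET (dn x t).
    by right; exists t; split=> //; move: xyt; clear; lia.
  by apply/fintype.subsetP => z; rewrite !inE => /orP[]/eqP-> //; rewrite -yE.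
Qed.

Lemma faces4_removable tau v : faces4 tau v -> removable stage3 tau v.
Proof.
move=> ft; have ev z := faces4_even (z := z) ft.
case: ft ev => i [j [l [u xi [xj xl] -> ->]]] ev.
split; [by apply/set0Pn; exists x; rewrite !inE eqxx|exact: notin_even|].
move=> s s3 /fintype.subsetP ts; have s0 := avoidW (avoidW (avoidW s3)).
have xs : x \in s by apply: ts; rewrite !inE eqxx.
have js : dd x i j \in s by apply: ts; rewrite !inE eqxx !orbT.
have ls : dd x i l \in s by apply: ts; rewrite !inE eqxx !orbT.
apply: stage3_add_dn => // y ys; have [yx _ _] := faces3P s3 xs ys.
(* The one vertex out of reach of [x - e_i] would complete a deleted tetrahedron below [x]. *)
have [//|yE] := between_dd u xi xj xl yx (stage0_near s0 ys js) (stage0_near s0 ys ls).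
exfalso; apply: (stage0_critical s0 (critical_ddd u xi xj xl)).
apply/fintype.subsetP => z; rewrite !inE -!orbA => /or4P[]/eqP-> //.
by rewrite -yE.
Qed.

Lemma faces5_removable tau v : faces5 tau v -> removable stage4 tau v.
Proof.
move=> ft; have ev z := faces5_even (z := z) ft.
case: ft ev => i [j [u xi xj -> ->]] ev.
split; [by apply/set0Pn; exists x; rewrite !inE eqxx|exact: notin_even|].
move=> s /[dup] s4 /avoidP[s3 f4] /fintype.subsetP ts.
have s0 := avoidW (avoidW (avoidW s3)).
have xs : x \in s by apply: ts; rewrite !inE eqxx.
have js : dd x i j \in s by apply: ts; rewrite !inE eqxx !orbT.
apply: stage4_add_dn => // y ys; have [yx le ge] := faces3P s3 xs ys.
have [//|[l [ul xl yE]]] := near_dn_of_dd u xi xj le ge yx (stage0_near s0 ys js).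
(* The vertices [x - e_i - e_j] and [x - e_j - e_l] share the index [j], so the fourth batch removed
   this edge. *)
have /f4/negP[] : faces4 [set x; dd x j i; dd x j l]%SET (dn x j).
  exists j, i, l; split=> //; have [[ij ji] [[il li] [jl lj]]] := uniq3E ul.
  by rewrite /= !inE ji jl il.
apply/fintype.subsetP => z; rewrite !inE -orbA => /or3P[]/eqP-> //.
- by rewrite ddC.
- by rewrite -yE.
Qed.

Lemma faces6_removable tau v : faces6 tau v -> removable stage5 tau v.
Proof.
case=> -> ->; split; first by apply/set0Pn; exists x; rewrite inE.
  by apply: notin_even => // z; rewrite inE => /eqP ->; rewrite manhattanxx.
move=> s /[dup] s5 /avoidP[s4 f5]; rewrite finset.sub1set => xs.
have s3 := avoidW s4.
apply: stage5_add_dn => // y ys; have [yx le ge] := faces3P s3 xs ys.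
(* Distance 2 is excluded by the fifth batch; a point within 1 of [x] is within 2 of [x - e_i0]. *)
have [y2|y2] := eqVneq (manhattan y x) 2%N; last first.
  apply: leq_trans (manhattan_dn_le _ xi0) _.
  by move: yx; rewrite leq_eqVlt (negbTE y2).
have [i [j [u xi xj yE]]] := two_below le ge y2.
have /f5/negP[] : faces5 [set x; dd x i j]%SET (dn x i) by exists i, j.
by apply/fintype.subsetP => z; rewrite !inE => /orP[]/eqP-> //; rewrite -yE.
Qed.

(** Every face ever removed contains [x], so once [x] is gone the other conditions hold by
    themselves. *)
Lemma stage6E s : stage6 s = VR2_deleted s && (s \subset U :\ x).
Proof.
rewrite subsetD1; apply/idP/idP => [/avoidP[s5 f6]|/and3P[Ks sU xs]].
  have := avoidW (avoidW (avoidW (avoidW (avoidW s5)))) => /andP[-> ->] /=.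
  by have := f6 [set x]%SET (dn x i0) (conj erefl erefl); rewrite finset.sub1set.
have a B (K : {set grid n m} -> bool) :
    (forall tau v, B tau v -> x \in tau) -> K s -> avoid B K s.
  move=> Bx Ks'; apply/avoidP; split=> // tau v /Bx xt.
  by apply: contra xs => /fintype.subsetP; apply.
rewrite /stage6; apply: (a); first by move=> tau v [-> _]; rewrite inE.
rewrite /stage5; apply: (a).
  by move=> tau v [i [j [_ _ _ -> _]]]; rewrite !inE eqxx.
rewrite /stage4; apply: (a).
  by move=> tau v [i [j [l [_ _ _ -> _]]]]; rewrite !inE eqxx.
rewrite /stage3; apply: (a).
  by move=> tau v [[j [k [_ _ _ -> _]]]|[i [_ -> _]]]; rewrite !inE eqxx.
rewrite /stage2; apply: (a).
  by move=> tau v [j [k [_ _ _ -> _]]]; rewrite !inE eqxx.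
rewrite /stage1; apply: (a).
  by move=> tau v [j [l [k [_ _ _ _ [-> _]]]]]; rewrite !inE eqxx.
by rewrite /stage0 Ks.
Qed.

Lemma apex3 tau v : faces3 tau v -> exists2 i, (0 < x i)%N & v = dn x i.
Proof.
case=> [[j [k [_ xj _ _ ->]]]|[i [xi _ ->]]]; first by exists j.
by exists i => //; apply: ltn_trans xi.
Qed.

Lemma contractible_remove_vertex {R : realType} (p : grid n m) :
  @contractible R _ (fun s => VR2_deleted s && (s \subset U :\ x)) p ->
  @contractible R _ stage0 p.
Proof.
move=> h; have d0 := down_closed_stage0.
have d1 := @avoid_down_closed _ faces1 _ d0.
have d2 := @avoid_down_closed _ faces2 _ d1.
have d3 := @avoid_down_closed _ faces3 _ d2.
have d4 := @avoid_down_closed _ faces4 _ d3.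
have d5 := @avoid_down_closed _ faces5 _ d4.
apply: (contractible_batch d0 faces1_removable faces1_apart).
apply: (contractible_batch d1 faces2_removable faces2_apart).
apply: (contractible_batch d2 faces3_removable).
  move=> tau v tau' v' /apex3[i xi ->] ft; apply: notin_even => // z.
  exact: faces3_even ft.
apply: (contractible_batch d3 faces4_removable).
  move=> tau v tau' v' [i [j [l [_ xi _ _ ->]]]] ft; apply: notin_even => // z.
  exact: faces4_even ft.
apply: (contractible_batch d4 faces5_removable).
  move=> tau v tau' v' [i [j [_ xi _ _ ->]]] ft; apply: notin_even => // z.
  exact: faces5_even ft.
apply: (contractible_batch d5 faces6_removable).
  move=> tau v tau' v' [_ ->] [-> _]; apply: notin_even => // z.
  by rewrite inE => /eqP ->; rewrite manhattanxx.
by apply: eq_contractible h => s; rewrite -stage6E.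
Qed.

End Elimination.

(** * Contractibility of the remainder and the count of spheres *)

Section Grid.
Context {n m : nat}.
Implicit Types (x y z : grid n m) (U : {set grid n m}).

Definition origin : grid n m := [ffun=> ord0].

Lemma weight_origin : weight origin = 0%N.
Proof. by rewrite /weight big1// => l _; rewrite ffunE muln0. Qed.

Lemma weight_eq0 x : weight x = 0%N -> x = origin.
Proof.
move=> /eqP; rewrite /weight sum_nat_eq0 => /forall_inP h; apply/ffunP => l.
apply: val_inj; have := h l isT; rewrite !ffunE muln_eq0 subn_eq0 leqNgt ltn_ord /=.
by move=> /eqP.
Qed.

Lemma VR2_deleted1 x : VR2_deleted [set x]%SET.
Proof.
apply/andP; split.
  apply/VR2P; split; first by apply/set0Pn; exists x; rewrite inE.
  by move=> y z; rewrite !inE => /eqP-> /eqP->; rewrite manhattanxx.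
by apply/negP => /tetrahedraP[]; rewrite cards1.
Qed.

(** Lower sets of [weight] suit the induction: apexes are lighter than the removed vertex, hence
    still in [U]. The strict inequality lets vertices of equal weight go in any order. *)
Lemma contractible_below (R : realType) U : origin \in U ->
  (forall y z, y \in U -> (weight z < weight y)%N -> z \in U) ->
  @contractible R _ (fun s => VR2_deleted s && (s \subset U)) origin.
Proof.
have [k] := ubnP #|U|; elim: k => // k IH in U *; rewrite ltnS => Uk U0 U_down.
have [x xU x_max] : exists2 x, x \in U & forall y, y \in U -> (weight y <= weight x)%N.
  case: (arg_maxnP (fun y : grid n m => weight y) U0) => x xU xmax.
  by exists x => // y yU; exact: xmax.
have [x0|x0] := eqVneq (weight x) 0%N.
  have UE : U = [set origin]%SET.
    apply/finset.setP => y; rewrite inE; apply/idP/eqP => [yU|->//].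
    by apply: weight_eq0; apply/eqP; rewrite -leqn0 -x0 x_max.
  apply: eq_contractible (contractible_vertex origin) => s; rewrite UE finset.subset1.
  apply/idP/idP => [/eqP->|/andP[sd /orP[//|/eqP s0]]].
    by rewrite VR2_deleted1 eqxx.
  by move: sd => /andP[/VR2P[]]; rewrite s0 eqxx.
have [i0 xi0 i0_min] : exists2 i0, (0 < x i0)%N & forall i, (0 < x i)%N -> (i0 <= i)%N.
  have [j xj] : exists j, (0 < x j)%N.
    apply: contrapT => /forallNP h; move/eqP: x0; apply; rewrite /weight big1// => l _.
    by have /negP := h l; rewrite -eqn0Ngt => /eqP ->; rewrite muln0.
  case: (arg_minnP (fun i : 'I_n => i : nat) (P := fun i => 0 < x i)%N xj) => i xi imin.
  by exists i.
apply: (contractible_remove_vertex xi0 i0_min U_down xU x_max); apply: IH.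
- by move: Uk; rewrite (cardsD1 x U) xU.
- rewrite !inE U0 andbT; apply/eqP => xo; move/eqP: x0; apply.
  by rewrite -xo weight_origin.
- move=> y z; rewrite !inE => /andP[yx yU] zy; rewrite (U_down _ _ yU zy) andbT.
  by apply: contraTneq zy => ->; rewrite -leqNgt x_max.
Qed.

Lemma VR2_homotopy_equivalent (R : realType) : @tetrahedra n m != finset.set0 ->
  homotopy_equivalent R (realization R (@VR_simplex n m 2))
    (wedge_S3 R #|@tetrahedra n m|).
Proof.
move=> T0; apply: (@homotopy_equivalent_wedge R _ _ _ origin) => //.
- exact: down_closed_VR2.
- move=> s /tetrahedraP cs; split; [by case: cs|exact: critical_VR2|].
  by move=> s'; exact: critical_facet.
- by have /andP[] := VR2_deleted1 origin.
- have := @contractible_below R finset.setT (finset.in_setT _).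
  move=> /(_ (fun y z _ _ => finset.in_setT z)); apply: eq_contractible => s.
  by rewrite finset.subsetT andbT.
Qed.

(** The first three coordinates contain [m ^ 3] unit cubes, and each contributes the tetrahedron
    below its top vertex, with all other coordinates 0. *)
Lemma card_tetrahedra : (3 <= n)%N -> (0 < m)%N -> (m ^ 3 <= #|@tetrahedra n m|)%N.
Proof.
move=> n3 m0.
pose i1 := Ordinal (leq_trans (isT : 0 < 3)%N n3).
pose i2 := Ordinal (leq_trans (isT : 1 < 3)%N n3).
pose i3 := Ordinal (leq_trans (isT : 2 < 3)%N n3).
have u : uniq [:: i1; i2; i3] by [].
(* [lift ord0] shifts the range to 1, ..., m, leaving room for the steps down. *)
pose top (a : 'I_m * 'I_m * 'I_m) : grid n m := [ffun l : 'I_n =>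
  if l == i1 then lift ord0 a.1.1 else if l == i2 then lift ord0 a.1.2
  else if l == i3 then lift ord0 a.2 else ord0].
have t1 a : (top a i1 : nat) = (a.1.1).+1 by rewrite ffunE eqxx.
have t2 a : (top a i2 : nat) = (a.1.2).+1 by rewrite ffunE.
have t3 a : (top a i3 : nat) = (a.2).+1 by rewrite ffunE.
pose f a : {set grid n m} :=
  [set top a; dd (top a) i1 i2; dd (top a) i1 i3; dd (top a) i2 i3]%SET.
have le a y : y \in f a -> forall l, (y l <= top a l)%N.
  by rewrite !inE -!orbA => /or4P[]/eqP-> l; rewrite ?ddE; clear; lia.
have ftop a : top a \in f a by rewrite !inE eqxx.
(* The top vertex is the coordinatewise maximum of its tetrahedron, hence determined by it. *)
have f_inj : injective f.
  move=> a b fab; have ab l : (top a l = top b l :> nat).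
    apply/eqP; rewrite eqn_leq (le b)//; first by rewrite (le a)// fab.
    by rewrite -fab.
  have := ab i1; have := ab i2; have := ab i3; rewrite !t1 !t2 !t3.
  move: a b {fab ab} => [[a1 a2] a3] [[b1 b2] b3] /= [e3] [e2] [e1].
  by congr (_, _, _); exact: val_inj.
have <- : #|f @: finset.setT| = (m ^ 3)%N.
  by rewrite card_imset// cardsT !card_prod !card_ord; ring.
apply: subset_leq_card; apply/fintype.subsetP => s /imsetP[a _ ->].
by apply/tetrahedraP; apply: critical_ddd => //; rewrite ?t1 ?t2 ?t3.
Qed.

End Grid.

(* Delta_m^{n,2} = VR({0,...,m}^n; 2) is homotopy equivalent to a wedge of
   nu copies of S^3 with nu >= (m-2)^3. *)
Theorem theorem4p13 (R : realType) (n m : nat) :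
  (3 <= n)%N -> (3 <= m)%N ->
  exists nu : nat, ((m - 2) ^ 3 <= nu)%N /\
    homotopy_equivalent R (realization R (@VR_simplex n m 2)) (wedge_S3 R nu).
Proof.
move=> n3 m3; have m0 : (0 < m)%N by exact: leq_trans m3.
have T := card_tetrahedra n3 m0; exists #|@tetrahedra n m|; split.
  by apply: leq_trans T; rewrite leq_exp2r// leq_subr.
apply: VR2_homotopy_equivalent; rewrite -card_gt0.
by apply: leq_trans T; rewrite expn_gt0 m0.
Qed.
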